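(* Let $M$ be a $6$-dimensional manifold endowed with a half-flat structure $(F,\Psi_+,\Psi_-)$. Let $f\colon N\to M$ be an oriented hypersurface of $M$ and denote the unit normal vector field by $\mathbb U$. Suppose that $$dF=2\Psi_+,\qquad \mathcal L_{\mathbb U}F=0,$$ where $\mathcal L$ denotes the Lie derivative. Then the forms $(\eta,\omega_1,\omega_2,\omega_3)$ on $N$ given by $$\eta=-i_{\mathbb U}F,\quad \omega_1=-i_{\mathbb U}\Psi_-,\quad \omega_2=f^*F,\quad \omega_3=-i_{\mathbb U}\Psi_+$$ define a hypo-contact structure on $N$.
   Context: An $SU(3)$-structure on a $6$-manifold is a triple $(F,\Psi_+,\Psi_-)$ for which locally there is a coframe $f^1,\dots,f^6$ with $F=f^{12}+f^{34}+f^{56}$ and $\Psi_++i\Psi_-=(f^1+if^2)\wedge(f^3+if^4)\wedge(f^5+if^6)$; such coframes are orthonormal for the associated Riemannian metric, with respect to which $\mathbb U$ is unit and normal to $N$. It is half-flat if $d(F\wedge F)=0$ and $d\Psi_+=0$. Contractions $i_{\mathbb U}$ of forms on $M$ are restricted (pulled back) to $N$. To make sense of $\mathcal L_{\mathbb U}$, $\mathbb U$ is regarded as a unit vector field on a neighbourhood of the hypersurface extending the unit normal. An $SU(2)$-structure on a $5$-manifold $N$ is a quadruplet $(\eta,\omega_1,\omega_2,\omega_3)$ with $\eta$ a nowhere vanishing $1$-form and $\omega_i$ $2$-forms such that $\omega_i\wedge\omega_j=\delta_{ij}v$ for some nowhere vanishing $4$-form $v$ with $v\wedge\eta\ne0$,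 and $i_X\omega_3=i_Y\omega_1\Rightarrow\omega_2(X,Y)\ge0$. It is hypo-contact if $d\eta=-2\omega_3$, $d(\eta\wedge\omega_1)=0$, $d(\eta\wedge\omega_2)=0$. *)

(* Defs.v *)
From HB Require Import structures.
From mathcomp Require Import all_boot all_order all_algebra all_fingroup.
From mathcomp Require Import all_classical all_reals all_analysis.
From mathcomp Require Import complex.
Set Implicit Arguments.
Unset Strict Implicit.
Unset Printing Implicit Defensive.
Import Order.TTheory GRing.Theory Num.Theory.
Import numFieldNormedType.Exports.
Local Open Scope classical_set_scope.
Local Open Scope ring_scope.

Fixpoint Cn_on (R : realType) (V W : normedModType R) (k : nat)
    (D : set V) (g : V -> W) : Prop :=
  match k with
  | 0 => forall x, D x -> {for x, continuous g}
  | k'.+1 => (forall x, D x -> differentiable g x) /\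
             (forall v, Cn_on k' D (fun x => 'd g x v))
  end.

(* Meaningful for D open. *)
Definition smooth_on (R : realType) (V W : normedModType R)
    (D : set V) (g : V -> W) : Prop := forall k, Cn_on k D g.

(* The values of cmap outside cdom, and of cinv outside cmap @` cdom, are
   irrelevant. *)
Record chart (R : realType) (n : nat) (T : topologicalType) := Chart {
  cdom : set T;
  cmap : T -> 'rV[R]_n;
  cinv : 'rV[R]_n -> T;
  cdom_open : open cdom;
  crange_open : open (cmap @` cdom);
  cmapK : forall p, cdom p -> cinv (cmap p) = p;
  cmap_continuous : forall p, cdom p -> {for p, continuous cmap};
  cinv_continuous : forall x, (cmap @` cdom) x -> {for x, continuous cinv} }.

(* chart_at selects, for every point, a chart around it. It is used only to
   represent the tangent space at p by 'rV_n: a row vector stands for the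
   tangent vector at p that has these coordinates in chart_at p. *)
Record manifold (R : realType) (n : nat) := Manifold {
  carrier :> topologicalType;
  atlas : set (chart R n carrier);
  chart_at : carrier -> chart R n carrier;
  chart_at_atlas : forall p, atlas (chart_at p);
  chart_at_dom : forall p, cdom (chart_at p) p;
  atlas_compatible : forall c c', atlas c -> atlas c' ->
    smooth_on (cmap c @` (cdom c `&` cdom c')) (cmap c' \o cinv c);
  manifold_hausdorff : hausdorff_space carrier;
  manifold_second_countable : @second_countable carrier }.

Section SmoothMaps.
Context {R : realType} {n m : nat} (N : manifold R n) (M : manifold R m).

Definition smooth_map (f : N -> M) : Prop :=
  continuous f /\
  forall c c', atlas c -> atlas c' ->
    smooth_on (cmap c @` (cdom c `&` f @^-1` cdom c'))
              (cmap c' \o f \o cinv c).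

(* Matrix of the tangent map at p, acting on row vectors on the right. *)
Definition tangent_map (f : N -> M) (p : N) : 'M[R]_(n, m) :=
  'J (cmap (chart_at (f p)) \o f \o cinv (chart_at p)) (cmap (chart_at p) p).

Definition immersion (f : N -> M) : Prop :=
  smooth_map f /\ forall p, row_free (tangent_map f p).

End SmoothMaps.

(* A k-linear form takes as argument the k x n matrix whose rows are the k
   vectors. *)

Definition multilinear_rows (R : nzRingType) (k n : nat)
    (a : 'M[R]_(k, n) -> R) : Prop :=
  forall (A B C : 'M[R]_(k, n)) (i : 'I_k) (b c : R),
    row i A = b *: row i B + c *: row i C ->
    row' i B = row' i A -> row' i C = row' i A ->
    a A = b * a B + c * a C.

Definition alternating_rows (R : nzRingType) (k n : nat)
    (a : 'M[R]_(k, n) -> R) : Prop :=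
  forall (A : 'M[R]_(k, n)) (i j : 'I_k), i != j -> row i A = row j A -> a A = 0.

(* (a /\ b)(v_1, ..., v_(k+l)) = 1/(k! l!) *
     \sum_s sgn(s) a(v_s(1), ..., v_s(k)) b(v_s(k+1), ..., v_s(k+l)),
   so that (a /\ b)(v, w) = a(v) b(w) - a(w) b(v) for 1-forms.
   Values in K, to cover complex-valued forms. *)
Definition ext_prod (R K : fieldType) (n k l : nat)
    (a : 'M[R]_(k, n) -> K) (b : 'M[R]_(l, n) -> K)
    (A : 'M[R]_(k + l, n)) : K :=
  (k`! * l`!)%:R^-1 *
  \sum_(s : 'S_(k + l))
     (-1) ^+ s * a (usubmx (row_perm s A)) * b (dsubmx (row_perm s A)).

Section Forms.
Context {R : realType} {n : nat} (M : manifold R n).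

Definition kform (k : nat) : Type := M -> 'M[R]_(k, n) -> R.
Definition vfield : Type := M -> 'rV[R]_n.

(* Coordinate expressions in the chart c, at the point of coordinates x. *)
Definition form_in (k : nat) (a : kform k) (c : chart R n M)
    (x : 'rV[R]_n) (A : 'M[R]_(k, n)) : R :=
  a (cinv c x) (A *m 'J (cmap (chart_at (cinv c x)) \o cinv c) x).

Definition vfield_in (X : vfield) (c : chart R n M) (x : 'rV[R]_n)
    : 'rV[R]_n :=
  let p := cinv c x in
  X p *m 'J (cmap c \o cinv (chart_at p)) (cmap (chart_at p) p).

Definition smooth_form_on (D : set M) (k : nat) (a : kform k) : Prop :=
  (forall p, D p -> multilinear_rows (a p) /\ alternating_rows (a p)) /\
  forall c (A : 'M[R]_(k, n)), atlas c ->
    smooth_on (cmap c @` (cdom c `&` D)) (fun x => form_in a c x A).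

Definition smooth_form (k : nat) (a : kform k) : Prop :=
  smooth_form_on setT a.

Definition smooth_vfield_on (D : set M) (X : vfield) : Prop :=
  forall c, atlas c -> smooth_on (cmap c @` (cdom c `&` D)) (vfield_in X c).

Definition nowhere_vanishing (k : nat) (a : kform k) : Prop :=
  forall p, exists A, a p A != 0.

Definition wedge (k l : nat) (a : kform k) (b : kform l) : kform (k + l) :=
  fun p => ext_prod (a p) (b p).

(* (i_X a)(v_1, ..., v_k) = a(X, v_1, ..., v_k) *)
Definition interior_prod (k : nat) (X : vfield) (a : kform k.+1) : kform k :=
  fun p A => a p (col_mx (X p) A).

(* In coordinates, da = \sum_j dx^j /\ (D_j a), that is
   (da)(v_0, ..., v_k) = \sum_i (-1)^i (D_(v_i) a)(v_0, .. omit v_i .., v_k). *)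
Definition ext_d (k : nat) (a : kform k) : kform k.+1 :=
  fun p A =>
    let c := chart_at p in
    \sum_(i < k.+1)
      (-1) ^+ i *
      'D_(row i A) (fun x => form_in a c x (row' i A)) (cmap c p).

(* (L_X a)(Y_1, ..., Y_k) =
     X(a(Y_1, ..., Y_k)) - \sum_i a(Y_1, ..., [X, Y_i], ..., Y_k)
   for fields Y_i with constant coordinates in the chart, for which
   [X, Y_i] = - D_(Y_i) X. *)
Definition lie_derivative (k : nat) (X : vfield) (a : kform k) : kform k :=
  fun p A =>
    let c := chart_at p in
    let x := cmap c p in
    'D_(vfield_in X c x) (fun y => form_in a c y A) x +
    \sum_(i < k)
      form_in a c x
        (\matrix_(j < k) if j == i then 'D_(row i A) (vfield_in X c) x
                         else row j A).

End Forms.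

Definition pullback (R : realType) (n m k : nat)
    (N : manifold R n) (M : manifold R m) (f : N -> M) (a : kform M k)
    : kform N k :=
  fun p A => a (f p) (A *m tangent_map f p).

(* (e 0, ..., e 5) is the coframe (f^1, ..., f^6) at one point. *)
Definition adapted_coframe (R : realType) (F : 'M[R]_(2, 6) -> R)
    (Psip Psim : 'M[R]_(3, 6) -> R) (e : 'I_6 -> 'rV[R]_6 -> R) : Prop :=
  let zeta (i j : 'I_6) : 'rV[R]_6 -> R[i] := fun v => (e i v +i* e j v)%C in
  [/\ (forall i, multilinear_rows (e i)),
      (forall r : 'I_6 -> R, (forall v, \sum_i r i * e i v = 0) ->
         forall i, r i = 0),
      (forall A, F A = ext_prod (e 0) (e 1) A + ext_prod (e 2) (e 3) A
                       + ext_prod (e 4) (e 5) A) &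
      (forall A, (Psip A +i* Psim A)%C =
         ext_prod (ext_prod (zeta 0 1) (zeta 2 3)) (zeta 4 5) A)].

Section SU3.
Context {R : realType} (M : manifold R 6).
Variables (F : kform M 2) (Psip Psim : kform M 3).

Definition SU3_structure : Prop :=
  [/\ smooth_form F, smooth_form Psip, smooth_form Psim &
      forall p : M, exists (D : set M) (e : 'I_6 -> kform M 1),
        [/\ open D, D p, forall i, smooth_form_on D (e i) &
            forall q, D q ->
              adapted_coframe (F q) (Psip q) (Psim q) (fun i => e i q)]].

(* The metric for which the adapted coframes are orthonormal. Two adapted
   coframes at p differ by an element of SU(3), hence of SO(6), so that the
   choice made by get is immaterial. *)
Definition SU3_metric (p : M) (v w : 'rV[R]_6) : R :=
  let e := get [set e | adapted_coframe (F p) (Psip p) (Psim p) e] in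
  \sum_(i < 6) e i v * e i w.

Definition half_flat : Prop :=
  [/\ SU3_structure,
      forall p A, ext_d (wedge F F) p A = 0 &
      forall p A, ext_d Psip p A = 0].

End SU3.

Section Hypersurface.
Context {R : realType} (M : manifold R 6) (N : manifold R 5).
Variables (F : kform M 2) (Psip Psim : kform M 3) (f : N -> M).

(* The orientation of N is the one for which mu is positive. *)
Definition oriented_hypersurface (mu : kform N 5) : Prop :=
  [/\ immersion f, smooth_form mu & nowhere_vanishing mu].

(* M is oriented by F /\ F /\ F = 6 f^123456, and N by requiring
   (U, v_1, ..., v_5) to be positive in M iff (v_1, ..., v_5) is so in N; this
   selects one of the two unit normals. U is a unit vector field on the
   neighbourhood D of f(N). *)
Definition unit_normal_on (mu : kform N 5) (D : set M) (U : vfield M) : Prop :=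
  [/\ open D, (forall p, D (f p)) & smooth_vfield_on D U] /\
  [/\ (forall q, D q -> SU3_metric F Psip Psim q (U q) (U q) = 1),
      (forall p v,
         SU3_metric F Psip Psim (f p) (U (f p)) (v *m tangent_map f p) = 0) &
      (forall p A,
         (0 < mu p A) =
         (0 < pullback f (interior_prod U (wedge (wedge F F) F)) p A))].

End Hypersurface.

Section SU2.
Context {R : realType} (N : manifold R 5).
Variables (eta : kform N 1) (omega1 omega2 omega3 : kform N 2).

Definition SU2_structure : Prop :=
  let omega (i : 'I_3) : kform N 2 := tnth [tuple omega1; omega2; omega3] i in
  [/\ smooth_form eta, nowhere_vanishing eta,
      forall i, smooth_form (omega i),
      exists v : kform N 4,
        [/\ smooth_form v, nowhere_vanishing v,
            nowhere_vanishing (wedge v eta) &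
            forall i j p A, wedge (omega i) (omega j) p A = (i == j)%:R * v p A] &
      forall p (X Y : 'rV[R]_5),
        (forall Z : 'rV[R]_5, omega3 p (col_mx X Z) = omega1 p (col_mx Y Z)) ->
        0 <= omega2 p (col_mx X Y)].

Definition hypo_contact : Prop :=
  [/\ SU2_structure,
      forall p A, ext_d eta p A = - 2 * omega3 p A,
      forall p A, ext_d (wedge eta omega1) p A = 0 &
      forall p A, ext_d (wedge eta omega2) p A = 0].

End SU2.

(* Main.v *)
(* At each point of N, SU(2) rotations in two pairs of complex directions turn an
   adapted coframe f^1, ..., f^6 into one in which U is dual to f^5. On N one has
   f^5 = 0, hence eta = - f^6, omega1 = - Im Z and omega3 = - Re Z for
   Z = (f^1 + i f^2) /\ (f^3 + i f^4), omega2 = f^12 + f^34, and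
   f^* Psi_+ = - eta /\ omega1; this gives the SU(2)-structure.
   Cartan's formula yields
     d eta = - f^* (L_U F) + f^* (i_U dF) = 2 f^* (i_U Psi_+) = - 2 omega3.
   Next d (eta /\ omega1) = - f^* (d Psi_+) = 0. Finally
   d omega2 = 2 f^* Psi_+ = - 2 eta /\ omega1 and the Leibniz rule give
   d (eta /\ omega2) = - 2 omega3 /\ omega2 + 2 eta /\ eta /\ omega1 = 0.
   That d commutes with pullbacks rests on the symmetry of second derivatives. *)
Require Import Defs.
From mathcomp Require Import all_boot all_order all_algebra all_fingroup.
From mathcomp Require Import all_classical all_reals all_analysis.
From mathcomp Require Import complex ring lra.
Set Implicit Arguments.
Unset Strict Implicit.
Unset Printing Implicit Defensive.
Import Order.TTheory GRing.Theory Num.Theory.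
Import numFieldNormedType.Exports.
Local Open Scope classical_set_scope.
Local Open Scope ring_scope.

(** * Smooth maps *)

(** The adapted coframe at a point of N is obtained by a choice, and the rotations are found from
    the value of U there, so nothing is known about how the result varies with the point. This does
    no harm: it only serves identities between values of forms at one point. Derivatives are taken
    solely of forms built from F, Psi_+, Psi_- and U, and the relation between f^* Psi_+ and eta /\
    omega1 is turned into an equality of forms before d is applied to it. On the analytic side,
    [chart_at p] varies with p without any continuity, so components taken in it are not smooth in
    p. Derivatives therefore act on expressions in one fixed chart, which bring in a Jacobian of
    change of chart. Smoothness of a form speaks of constant arguments only; pullbacks, interior
    products and the Lie derivative insert Jacobians or vector fields that vary with the point.
    Hence the product rule for multilinear forms with both coefficients and arguments variable, on
    which the pullback rule and Cartan's formula rest. *)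

Section Differential.
Context {R : realType}.
Implicit Types V W : normedModType R.

(** [g - f] vanishes near [x], hence is a little-o of the increment and has differential 0; then
    [g = f + (g - f)]. *)
Lemma differentiable_near_eq V W (f g : V -> W) (x : V) :
  (\near x, f x = g x) -> differentiable f x -> differentiable g x.
Proof.
move=> fg df.
have -> : g = f + (g - f) by rewrite addrC subrK.
apply: differentiableD => //.
have h0 : (g - f) \o shift x = cst ((g - f) x) + (0 : V -> W) +o_ 0 id.
  apply/eqaddoP => _/posnumP[e] /=.
  rewrite (_ : (g - f) x = 0); last first.
    by rewrite /= /GRing.add/= /GRing.opp/= (nbhs_singleton fg) subrr.
  have : \forall y \near 0, f (y + x) = g (y + x).
    have := fg; rewrite (near_shift 0) /=.
    by apply: filterS => y /=; rewrite subr0.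
  apply: filterS => y E; rewrite /= !fctE /= E subrr addr0 subrr normr0.
  by rewrite mulr_ge0.
apply/diff_locallyP.
have dE : 'd (g - f) x = (0 : V -> W) :> (V -> W).
  apply: (@diff_unique _ _ _ _ \0) => //.
  exact: cst_continuous.
split; first by rewrite dE; exact: cst_continuous.
by rewrite dE.
Qed.

Lemma diff_near_eq V W (f g : V -> W) (x : V) :
  (\near x, f x = g x) -> differentiable f x -> 'd f x = 'd g x :> (V -> W).
Proof.
move=> fg df; have dg := differentiable_near_eq fg df.
by apply/funext => v; rewrite -!deriveE//; exact: near_eq_derive.
Qed.

End Differential.

(** * Calculus of C^k functions *)

Section Smooth.
Context {R : realType}.
Implicit Types (V W : normedModType R) (k : nat).

Lemma Cn_onS V W k (D E : set V) (g : V -> W) :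
  E `<=` D -> Cn_on k D g -> Cn_on k E g.
Proof.
move=> ED; elim: k g => [|k IH] g /=; first by move=> H x /ED/H.
by case=> H1 H2; split=> [x /ED/H1//|v]; exact: IH.
Qed.

Lemma Cn_on_succ V W k (D : set V) (g : V -> W) :
  Cn_on k.+1 D g -> Cn_on k D g.
Proof.
elim: k g => [|k IH] g [H1 H2].
  by move=> x /H1; exact: differentiable_continuous.
by split=> // v; exact: IH.
Qed.

(** [Cn_on] is a condition at each point on the ambient function, not on its restriction, so [E]
    need be neither open nor contained in [D]. *)
Lemma Cn_on_local V W k (D : set V) (g : V -> W) :
  (forall x, D x -> exists2 E, E x & Cn_on k E g) -> Cn_on k D g.
Proof.
elim: k g => [|k IH] g H /=.
  by move=> x /H[E Ex]; apply.
split=> [x /H[E Ex [+ _]]|v]; first exact.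
by apply: IH => x /H[E Ex [_ HE]]; exists E => //; exact: HE.
Qed.

Lemma Cn_on_ext V W k (D : set V) (f g : V -> W) : open D ->
  (forall x, D x -> f x = g x) -> Cn_on k D f -> Cn_on k D g.
Proof.
move=> oD; elim: k f g => [|k IH] f g fg.
  move=> cf x Dx; have H : f y @[y --> x] --> f x := cf x Dx.
  suff : g y @[y --> x] --> g x by [].
  rewrite -(fg x Dx).
  apply: cvg_trans H; apply: near_eq_cvg.
  by near=> y; apply: fg; near: y; exact: open_nbhs_nbhs.
have nfg x : D x -> \near x, f x = g x.
  by move=> Dx; near=> y; apply/fg; near: y; exact: open_nbhs_nbhs.
move=> [df H]; split=> [x Dx|v].
  exact: differentiable_near_eq (nfg x Dx) (df x Dx).
apply: IH (H v) => x Dx.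
by rewrite (diff_near_eq (nfg x Dx))//; exact: df.
Unshelve. all: by end_near. Qed.

Lemma Cn_on_cst V W k (D : set V) (a : W) : Cn_on k D (fun=> a).
Proof.
elim: k a => [|k IH] a /=; first by move=> x _; exact: cst_continuous.
split=> [x _|v]; first exact: differentiable_cst.
by under eq_fun do rewrite -[fun=> a]/(cst a) diff_cst; exact: IH.
Qed.

Lemma Cn_onD V W k (D : set V) (f g : V -> W) : open D ->
  Cn_on k D f -> Cn_on k D g -> Cn_on k D (fun x => f x + g x).
Proof.
move=> oD; elim: k f g => [|k IH] f g.
  by move=> cf cg x Dx; apply: cvgD; [exact: cf|exact: cg].
move=> [df Hf] [dg Hg]; split=> [x Dx|v].
  by apply: differentiableD; [exact: df|exact: dg].
apply: Cn_on_ext oD _ (IH _ _ (Hf v) (Hg v)) => x Dx.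
rewrite -[fun x => f x + g x]/(f + g) diffD//; [exact: df|exact: dg].
Qed.

Lemma Cn_onN V W k (D : set V) (f : V -> W) : open D ->
  Cn_on k D f -> Cn_on k D (fun x => - f x).
Proof.
move=> oD; elim: k f => [|k IH] f.
  by move=> cf x Dx; apply: cvgN; exact: cf.
move=> [df Hf]; split=> [x Dx|v].
  by apply: differentiableN; exact: df.
apply: Cn_on_ext oD _ (IH _ (Hf v)) => x Dx.
rewrite -[fun x => - f x]/(- f) diffN//; exact: df.
Qed.

Lemma Cn_onM V k (D : set V) (f g : V -> R) : open D ->
  Cn_on k D f -> Cn_on k D g -> Cn_on k D (fun x => f x * g x).
Proof.
move=> oD; elim: k f g => [|k IH] f g.
  by move=> cf cg x Dx; apply: cvgM; [exact: cf|exact: cg].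
move=> Hf0 Hg0; have [df Hf] := Hf0; have [dg Hg] := Hg0.
split=> [x Dx|v].
  by apply: differentiableM; [exact: df|exact: dg].
have := Cn_onD oD (IH _ _ (Cn_on_succ Hf0) (Hg v)) (IH _ _ (Cn_on_succ Hg0) (Hf v)).
apply: Cn_on_ext oD _ => x Dx.
by rewrite -[fun x => f x * g x]/(f * g) diffM//; [exact: df|exact: dg].
Qed.

Lemma Cn_on_sum V W k (D : set V) (I : Type) (r : seq I) (P : pred I)
    (f : I -> V -> W) : open D ->
  (forall i, Cn_on k D (f i)) -> Cn_on k D (fun x => \sum_(i <- r | P i) f i x).
Proof.
move=> oD Hf; elim: r => [|i r IH].
  by under eq_fun do rewrite big_nil; exact: Cn_on_cst.
under eq_fun do rewrite big_cons.
by case: (P i) => //; exact: Cn_onD.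
Qed.

Lemma differentiable_mx_entry V (p q : nat) (g : V -> 'M[R]_(p, q)) x i j :
  differentiable g x -> differentiable (fun y => g y i j) x.
Proof.
move=> dg; apply: (@differentiable_comp _ _ _ _ g (fun M : 'M[R]_(p, q) => M i j)) => //.
exact: differentiable_coord.
Qed.

Lemma diff_mx_entry V (p q : nat) (g : V -> 'M[R]_(p, q)) x v i j :
  differentiable g x -> 'd (fun y => g y i j) x v = ('d g x v) i j.
Proof.
move=> dg; rewrite -!deriveE//; last exact: differentiable_mx_entry.
by rewrite derive_mx ?mxE//; exact: diff_derivable.
Qed.

Lemma differentiable_mx V (p q : nat) (g : V -> 'M[R]_(p, q)) x :
  (forall i j, differentiable (fun y => g y i j) x) -> differentiable g x.
Proof.
move=> H.
have -> : g = \sum_i \sum_j (fun y => g y i j *: delta_mx i j).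
  apply/funext => y; rewrite [LHS]matrix_sum_delta fct_sumE.
  by apply: eq_bigr => i _; rewrite fct_sumE.
apply: differentiable_sum => i; apply: differentiable_sum => j.
by apply: differentiableZl; exact: H.
Qed.

Lemma Cn_on_mx V (p q : nat) k (D : set V) (g : V -> 'M[R]_(p, q)) : open D ->
  Cn_on k D g <-> forall i j, Cn_on k D (fun x => g x i j).
Proof.
move=> oD; elim: k g => [|k IH] g; split.
- move=> cg i j x Dx.
  apply: (@continuous_comp _ _ _ g (fun M : 'M[R]_(p, q) => M i j)); first exact: cg.
  exact: coord_continuous.
- move=> cg x Dx; apply/cvgrPdist_le => /= e e0; near=> y.
  rewrite [leLHS]/Num.Def.normr/= mx_normrE (bigmax_le _ (ltW e0))//= => i _.
  rewrite !mxE/=.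
  move: i; near: y; apply: filter_forall => /= i.
  exact: (cvgrPdist_le _ _).1 (cg i.1 i.2 x Dx) e e0.
- move=> [dg Hg] i j; split=> [x Dx|v].
    by apply: differentiable_mx_entry; exact: dg.
  apply: Cn_on_ext oD _ ((IH _).1 (Hg v) i j) => x Dx.
  by rewrite diff_mx_entry//; exact: dg.
- move=> H; have dg x : D x -> differentiable g x.
    by move=> Dx; apply: differentiable_mx => i j; have [+ _] := H i j; exact.
  split=> // v; apply/IH => i j; have [_ Hij] := H i j.
  apply: Cn_on_ext oD _ (Hij v) => x Dx.
  by rewrite diff_mx_entry//; exact: dg.
Unshelve. all: by end_near. Qed.

Lemma Cn_on_rV V (q : nat) k (D : set V) (g : V -> 'rV[R]_q) : open D ->
  (forall j, Cn_on k D (fun x => g x 0 j)) -> Cn_on k D g.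
Proof. by move=> oD H; apply/(Cn_on_mx k _ oD) => i j; rewrite (ord1 i); exact: H. Qed.

Lemma diff_rV_sum (W : normedModType R) (q : nat) (g : 'rV[R]_q -> W) y (v : 'rV[R]_q) :
  'd g y v = \sum_i v 0 i *: 'd g y (delta_mx 0 i).
Proof.
by rewrite {1}(row_sum_delta v) linear_sum; apply: eq_bigr => i _; rewrite linearZ.
Qed.

(** [Cn_on] controls a differential only on constant vectors, while the chain rule evaluates that of
    [g] on the moving vector ['d f x v]. Expanding this vector in the standard basis leaves products
    of C^k functions. *)
Lemma Cn_on_comp_real V (q : nat) k (D : set V) (E : set 'rV[R]_q)
    (f : V -> 'rV[R]_q) (g : 'rV[R]_q -> R) : open D ->
  (forall x, D x -> E (f x)) ->
  Cn_on k D f -> Cn_on k E g -> Cn_on k D (fun x => g (f x)).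
Proof.
move=> oD DE; elim: k f g DE => [|k IH] f g DE Hf0 Hg0.
  move=> x Dx; apply: (@continuous_comp _ _ _ f g); first exact: Hf0.
  by apply: Hg0; exact: DE.
have [df Hf] := Hf0; have [dg Hg] := Hg0.
split=> [x Dx|v].
  by apply: (@differentiable_comp _ _ _ _ f g); [exact: df|exact/dg/DE].
have H (i : 'I_q) : Cn_on k D (fun x => 'd f x v 0 i * 'd g (f x) (delta_mx 0 i)).
  apply: Cn_onM => //; first by move/(Cn_on_mx k _ oD): (Hf v); exact.
  apply: (IH f (fun y => 'd g y (delta_mx 0 i)) DE).
    exact: Cn_on_succ Hf0.
  exact: Hg.
apply: Cn_on_ext oD _ (Cn_on_sum (index_enum 'I_q) xpredT oD H) => x Dx.
by rewrite [in RHS](@diff_comp _ _ _ _ f g)/= ?[RHS]diff_rV_sum//; [exact: df|exact/dg/DE].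
Qed.

Lemma smooth_on_diff V W (D : set V) (g : V -> W) v :
  smooth_on D g -> smooth_on D (fun x => 'd g x v).
Proof. by move=> H k; have [_] := H k.+1; exact. Qed.

Lemma smooth_on_differentiable V W (D : set V) (g : V -> W) x :
  smooth_on D g -> D x -> differentiable g x.
Proof. by move=> H; have [+ _] := H 1%N; exact. Qed.

Lemma Cn_on_jacobian (p q : nat) k (D : set 'rV[R]_p) (g : 'rV[R]_p -> 'rV[R]_q) :
  open D -> Cn_on k.+1 D g -> Cn_on k D (fun x => jacobian g x).
Proof.
move=> oD [_ H]; apply/Cn_on_mx => // i j.
apply: Cn_on_ext oD _ ((Cn_on_mx k _ oD).1 (H (delta_mx 0 i)) 0 j) => x Dx.
by rewrite /jacobian mxE.
Qed.

End Smooth.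

(** * Symmetry of second derivatives *)

Section Young.
Context {R : realType} {V : normedModType R}.
Implicit Types (g : V -> R) (a v w x : V).

Lemma is_derive_line g a v (t : R) : differentiable g (t *: v + a) ->
  is_derive t 1 (fun s : R => g (s *: v + a)) ('d g (t *: v + a) v).
Proof.
move=> dg.
have dl : is_diff t (fun s : R => s *: v + a) (fun s : R => s *: v).
  have := is_diffD (is_diff_scalel t v) (is_diff_cst a t).
  by rewrite addr0; apply.
have dgl : differentiable (fun s : R => g (s *: v + a)) t.
  apply: (@differentiable_comp _ _ _ _ (fun s : R => s *: v + a) g) => //.
apply: DeriveDef; first exact: diff_derivable.
rewrite deriveE//.
rewrite (@diff_comp _ _ _ _ (fun s : R => s *: v + a) g)//.
by rewrite /= diff_val scale1r.
Qed.

(* The mean value theorem is applied to t |-> g (t v + h w + x) - g (t v + x)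
   on [0, h]. *)
Lemma second_difference g x v w (e : R) : 0 < e ->
  (\near x, differentiable g x) -> differentiable (fun y => 'd g y v) x ->
  \forall h \near (0 : R)^'+,
    `|g (h *: v + (h *: w + x)) - g (h *: v + x) - (g (h *: w + x) - g x)
      - h ^+ 2 * 'd (fun y => 'd g y v) x w| <= e * h ^+ 2.
Proof.
move=> e0 dg dG; set G := fun y => 'd g y v.
(* The first-order errors at [t v + h w] and at [t v] are bounded by [e / M * h] times [|v| + |w|]
   and [|v|]; their sum stays below [e * h]. The summand 1 keeps [M] positive when [v] and [w]
   vanish. *)
pose M := 2 * `|v| + `|w| + 1.
have M0 : 0 < M by rewrite ltr_wpDl// addr_ge0// mulr_ge0.
have /eqaddoP/(_ (e / M) (divr_gt0 e0 M0)) := diff_locally dG.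
move=> /nbhs_normP[r1 /= r10 H1].
have /nbhs_normP[r2 /= r20 H2] := dg.
near=> h.
have h0 : 0 < h by [].
have hM : h * M < Num.min r1 r2.
  rewrite -ltr_pdivlMr//; near: h; apply: nbhs_right_lt.
  by rewrite divr_gt0// lt_min r10.
have small t : 0 <= t <= h -> `|t *: v + h *: w| <= h * (`|v| + `|w|)
     /\ `|t *: v| <= h * `|v|.
  move=> /andP[t0 th].
  have tv : `|t *: v| <= h * `|v| by rewrite normrZ ger0_norm// ler_wpM2r.
  split=> //; rewrite (le_trans (ler_normD _ _))// mulrDr lerD//.
  by rewrite normrZ gtr0_norm.
have hvw : h * (`|v| + `|w|) < Num.min r1 r2.
  apply: le_lt_trans hM; rewrite ler_wpM2l ?(ltW h0)// /M.
  by have := normr_ge0 v; have := normr_ge0 w; lra.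
have hv : h * `|v| < Num.min r1 r2.
  by apply: le_lt_trans hvw; rewrite ler_wpM2l ?lerDl// ltW.
have d2 t : 0 <= t <= h -> differentiable g (t *: v + (h *: w + x)) /\
   differentiable g (t *: v + x).
  move=> /small[A B]; split; apply: H2 => /=.
    rewrite addrA opprD addrCA subrr addr0 normrN.
    by rewrite (le_lt_trans A)// (lt_le_trans hvw)// ge_min lexx orbT.
  rewrite opprD addrCA subrr addr0 normrN.
  by rewrite (le_lt_trans B)// (lt_le_trans hv)// ge_min lexx orbT.
pose psi (t : R) := g (t *: v + (h *: w + x)) - g (t *: v + x).
pose dpsi (t : R) := G (t *: v + (h *: w + x)) - G (t *: v + x).
have ispsi t : 0 <= t <= h -> is_derive t 1 psi (dpsi t).
  move=> /d2[A B]; apply: is_deriveB; exact: is_derive_line.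
have cpsi : {within `[0, h], continuous psi}.
  apply: continuous_in_subspaceT => t.
  rewrite inE/= in_itv/= => /ispsi[A _].
  by apply: differentiable_continuous; exact/derivable1_diffP.
have [t tI] := MVT h0 (fun t tI => ispsi t (ltac:(by move: tI; rewrite in_itv/= => /andP[/ltW -> /ltW ->]))) cpsi.
rewrite {1 2}/psi !scale0r !add0r subr0 => ->.
have tI' : 0 <= t <= h by move: tI; rewrite in_itv/= => /andP[/ltW -> /ltW ->].
rewrite mulrC expr2 -mulrA -mulrBr normrM gtr0_norm// mulrCA ler_wpM2l ?(ltW h0)//.
have [A B] := small t tI'.
have E1 := H1 (t *: v + h *: w); have E2 := H1 (t *: v).
have {}E1 : `|G (t *: v + h *: w + x) - (G x + 'd G x (t *: v + h *: w))| <=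
    e / M * (h * (`|v| + `|w|)).
  apply: le_trans (E1 _) _.
    by rewrite /= sub0r normrN (le_lt_trans A)// (lt_le_trans hvw)// ge_min lexx.
  by rewrite ler_wpM2l// divr_ge0// ltW.
have {}E2 : `|G (t *: v + x) - (G x + 'd G x (t *: v))| <= e / M * (h * `|v|).
  apply: le_trans (E2 _) _.
    by rewrite /= sub0r normrN (le_lt_trans B)// (lt_le_trans hv)// ge_min lexx.
  by rewrite ler_wpM2l// divr_ge0// ltW.
(* The linear parts in [t v] cancel, which leaves the difference of two first-order remainders of
   [G] at [x]. *)
have -> : dpsi t - h * 'd G x w =
   (G (t *: v + h *: w + x) - (G x + 'd G x (t *: v + h *: w))) -
   (G (t *: v + x) - (G x + 'd G x (t *: v))).
  have -> : 'd G x (t *: v + h *: w) = 'd G x (t *: v) + h * 'd G x w.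
    by rewrite linearD [X in _ + X]linearZ.
  by rewrite /dpsi addrA; ring.
apply: le_trans (ler_normB _ _) _.
apply: le_trans (lerD E1 E2) _.
have -> : e * h = e / M * M * h by rewrite divfK// gt_eqF.
have : 0 <= e / M * h by rewrite mulr_ge0 ?divr_ge0 ?ltW.
by set q := e / M; rewrite /M; lra.
Unshelve. all: by end_near. Qed.

(** The second difference is symmetric in [v] and [w], so both mixed derivatives, multiplied by
    [h ^+ 2], lie within [e / 2 * h ^+ 2] of one number. *)
Lemma young g x v w : (\near x, differentiable g x) ->
  differentiable (fun y => 'd g y v) x -> differentiable (fun y => 'd g y w) x ->
  'd (fun y => 'd g y v) x w = 'd (fun y => 'd g y w) x v.
Proof.
move=> dg dv dw; apply/eqP; rewrite -subr_eq0 -normr_le0; apply/ler_addgt0Pl => e e0.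
rewrite addr0.
have e20 : 0 < e / 2 by rewrite divr_gt0.
near (0 : R)^'+ => h.
have h0 : 0 < h by [].
have h20 : 0 < h ^+ 2 by rewrite exprn_gt0.
rewrite -(ler_pM2r h20).
have Hv : `|g (h *: v + (h *: w + x)) - g (h *: v + x) - (g (h *: w + x) - g x)
      - h ^+ 2 * 'd (fun y => 'd g y v) x w| <= e / 2 * h ^+ 2.
  by near: h; exact: second_difference.
have Hw : `|g (h *: w + (h *: v + x)) - g (h *: w + x) - (g (h *: v + x) - g x)
      - h ^+ 2 * 'd (fun y => 'd g y w) x v| <= e / 2 * h ^+ 2.
  by near: h; exact: second_difference.
move: Hv Hw; rewrite (addrCA (h *: w)).
set a := 'd _ _ _; set b := 'd _ _ _.
rewrite -[X in `|_| * X]gtr0_norm// -normrM !ler_norml => /andP[A B] /andP[C D].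
by apply/andP; split; lra.
Unshelve. all: by end_near. Qed.

End Young.

(** * Multilinear and alternating forms *)

Section Multilinear.
Context {R : comNzRingType}.
Implicit Types k n : nat.

(** The same matrix as in the bracket terms of [lie_derivative], which thus are instances of it. *)
Definition set_row k n (i : 'I_k) (v : 'rV[R]_n) (A : 'M[R]_(k, n)) : 'M[R]_(k, n) :=
  \matrix_(j < k) if j == i then v else row j A.

Lemma set_rowE k n (i : 'I_k) (v : 'rV[R]_n) A (j : 'I_k) l :
  set_row i v A j l = if j == i then v 0 l else A j l.
Proof. by rewrite mxE; case: ifP => // _; rewrite mxE. Qed.

Lemma row_set_row k n (i j : 'I_k) (v : 'rV[R]_n) A :
  row j (set_row i v A) = if j == i then v else row j A.
Proof. by rewrite rowK. Qed.

Lemma set_row_row k n (i : 'I_k) (A B : 'M[R]_(k, n)) :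
  row' i A = row' i B -> set_row i (row i A) B = A.
Proof.
move=> E; apply/matrixP => j l; rewrite set_rowE; case: eqVneq => [->|ji].
  by rewrite mxE.
case: (unliftP i j) ji => [j' ->|-> /eqP//] _.
by move/matrixP: E => /(_ j' l); rewrite !mxE.
Qed.

Lemma row'_set_row k n (i : 'I_k) (v : 'rV[R]_n) A : row' i (set_row i v A) = row' i A.
Proof. by apply/matrixP => j l; rewrite mxE set_rowE eq_sym (negPf (neq_lift _ _)) mxE. Qed.

Lemma multilinear_rowsP k n (a : 'M[R]_(k, n) -> R) :
  multilinear_rows a <-> forall i A u w b c,
  a (set_row i (b *: u + c *: w) A) = b * a (set_row i u A) + c * a (set_row i w A).
Proof.
split=> H => [i A u w b c|A B C i b c].
  by apply: (H _ _ _ i); rewrite ?row_set_row ?eqxx ?row'_set_row.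
move=> EA EB EC; rewrite -(@set_row_row _ _ i A A)// EA H.
by rewrite (set_row_row EB) (set_row_row EC).
Qed.

Lemma multilinear_set_row0 k n (a : 'M[R]_(k, n) -> R) i A :
  multilinear_rows a -> a (set_row i 0 A) = 0.
Proof.
move=> /multilinear_rowsP H; have := H i A 0 0 0 0.
by rewrite !scale0r addr0 !mul0r addr0.
Qed.

Lemma multilinear_set_rowD k n (a : 'M[R]_(k, n) -> R) i A u w :
  multilinear_rows a -> a (set_row i (u + w) A) = a (set_row i u A) + a (set_row i w A).
Proof.
by move=> /multilinear_rowsP H; rewrite -[u]scale1r -[w]scale1r H !scale1r !mul1r.
Qed.

Lemma multilinear_set_rowZ k n (a : 'M[R]_(k, n) -> R) i A b u :
  multilinear_rows a -> a (set_row i (b *: u) A) = b * a (set_row i u A).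
Proof.
move=> /multilinear_rowsP H; rewrite -[b *: u]addr0 -[0 in LHS](scale0r 0) H.
by rewrite mul0r addr0.
Qed.

Lemma multilinear_set_row_sum k n (a : 'M[R]_(k, n) -> R) i A (u : 'rV[R]_n) :
  multilinear_rows a ->
  a (set_row i u A) = \sum_j u 0 j * a (set_row i (delta_mx 0 j) A).
Proof.
move=> ma; rewrite {1}(row_sum_delta u).
pose P (x : 'rV[R]_n) (y : R) := a (set_row i x A) = y.
apply: (big_ind2 P) => [|x1 x2 y1 y2 <- <-|j _]; rewrite /P.
- exact: multilinear_set_row0.
- exact: multilinear_set_rowD.
- exact: multilinear_set_rowZ.
Qed.

Lemma set_row_col_mx0 k n (u v : 'rV[R]_n) (A : 'M[R]_(k, n)) :
  @set_row k.+1 n ord0 v (col_mx u A) = col_mx v A.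
Proof.
have -> : (ord0 : 'I_k.+1) = @lshift 1 k ord0 by exact: val_inj.
apply/matrixP => i j; rewrite set_rowE.
case: (@splitP 1 k i) => i' E.
  have -> : i = @lshift 1 k ord0 by apply/val_inj; rewrite /= E ord1.
  by rewrite eqxx; exact/esym/(col_mxEu v A).
have -> : i = @rshift 1 k i' by apply/val_inj.
rewrite -val_eqE /=.
by apply: etrans (col_mxEd u A i' j) _; exact/esym/(col_mxEd v A).
Qed.

Lemma set_row_col_mxS k n (u v : 'rV[R]_n) (A : 'M[R]_(k, n)) i :
  set_row (rshift 1 i) v (col_mx u A) = col_mx u (set_row i v A).
Proof.
apply/matrixP => i' j; rewrite set_rowE.
case: (splitP i') => i1 E.
  have -> : i' = lshift k i1 by apply/val_inj.
  by rewrite eq_lrshift !col_mxEu.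
have -> : i' = rshift 1 i1 by apply/val_inj.
by rewrite !col_mxEd (inj_eq (@rshift_inj _ _)) set_rowE.
Qed.

Lemma multilinear_col_mx k n (a : 'M[R]_(1 + k, n) -> R) u :
  multilinear_rows a -> multilinear_rows (fun A => a (col_mx u A)).
Proof.
move=> /multilinear_rowsP H; apply/multilinear_rowsP => i A v w b c.
by rewrite -!set_row_col_mxS H.
Qed.

(** Each coefficient is a form of one degree less, with a constant vector in its first slot;
    inductions on the degree rest on this expansion. *)
Lemma multilinear_first_row k n (a : 'M[R]_(1 + k, n) -> R) A :
  multilinear_rows a ->
  a A = \sum_j A 0 j * a (col_mx (delta_mx 0 j : 'rV[R]_n) (dsubmx A)).
Proof.
move=> ma; rewrite -{1}(vsubmxK A) -{1}(set_row_col_mx0 0 (usubmx A)).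
rewrite multilinear_set_row_sum//; apply: eq_bigr => j _.
rewrite set_row_col_mx0; congr (_ * _).
by rewrite mxE; congr (A _ _); apply/val_inj.
Qed.

End Multilinear.

(** * Multilinear forms whose coefficients and arguments both vary *)

Section MultilinearCalculus.
Context {R : realType} {V : normedModType R}.
Implicit Types k n : nat.

Lemma Cn_on_multilinear k n r (D : set V) (a : V -> 'M[R]_(k, n) -> R) (B : V -> 'M[R]_(k, n)) :
  open D -> (forall x, D x -> multilinear_rows (a x)) ->
  (forall A, Cn_on r D (fun x => a x A)) -> Cn_on r D B -> Cn_on r D (fun x => a x (B x)).
Proof.
move=> oD; elim: k a B => [|k IH] a B ma ca cB.
  by under eq_fun do rewrite (flatmx0 (B _)); exact: ca.
have H (j : 'I_n) : Cn_on r D (fun x => B x 0 j * a x (col_mx (delta_mx 0 j : 'rV[R]_n) (@dsubmx R 1 k n (B x)))).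
  apply: Cn_onM => //; first by move/Cn_on_mx: cB; exact.
  apply: (IH (fun x A => a x (col_mx (delta_mx 0 j : 'rV[R]_n) A))) => //.
    by move=> x Dx; apply: multilinear_col_mx; exact: ma.
  apply/Cn_on_mx => // i l.
  apply: Cn_on_ext oD _ ((Cn_on_mx r _ oD).1 cB (rshift 1 i) l) => x Dx.
  by rewrite mxE.
apply: Cn_on_ext oD _ (Cn_on_sum (index_enum 'I_n) xpredT oD H) => x Dx.
by rewrite [RHS]multilinear_first_row//; exact: ma.
Qed.

(** Product rule: one term for the coefficients and one for each row of the argument. Induction on
    [k] by expansion along the first row; differentiability is proved along with the formula because
    the product rule at the next degree asks for it. *)
Lemma derive_multilinear k n (a : V -> 'M[R]_(k, n) -> R) (B : V -> 'M[R]_(k, n)) x v :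
  (\near x, multilinear_rows (a x)) ->
  (forall A, differentiable (fun x => a x A) x) -> differentiable B x ->
  differentiable (fun y => a y (B y)) x /\
  'D_v (fun y => a y (B y)) x =
    'D_v (fun y => a y (B x)) x + \sum_i a x (set_row i ('D_v (fun y => row i (B y)) x) (B x)).
Proof.
elim: k a B => [|k IH] a B ma da dB.
  have E : (fun y => a y (B y)) = (fun y => a y 0).
    by apply/funext => y; rewrite (flatmx0 (B y)).
  by rewrite E big_ord0 addr0 (flatmx0 (B x)); split.
pose B' y : 'M[R]_(k, n) := @dsubmx R 1 k n (B y).
pose a' j y (A : 'M[R]_(k, n)) := a y (col_mx (delta_mx 0 j : 'rV[R]_n) A).
have dB' : differentiable B' x.
  apply: differentiable_mx => i j; under eq_fun do rewrite mxE.
  exact: differentiable_mx_entry.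
have ma' j : \near x, multilinear_rows (a' j x).
  by apply: filterS ma => y; exact: multilinear_col_mx.
have {}IH j := IH (a' j) B' (ma' j) (fun A => da (col_mx (delta_mx 0 j : 'rV[R]_n) A)) dB'.
have dB0 j : is_derive x v (fun y => B y 0 j) ('D_v (fun y => B y 0 j) x).
  by apply: derivableP; apply: diff_derivable; exact: differentiable_mx_entry.
have E : \forall y \near x, \sum_j B y 0 j * a' j y (B' y) = a y (B y).
  by apply: filterS ma => y my; rewrite [RHS]multilinear_first_row.
have E' : \forall y \near x, \sum_j B x 0 j * a' j y (B' x) = a y (B x).
  by apply: filterS ma => y my; rewrite [RHS]multilinear_first_row.
have max : multilinear_rows (a x) by exact: nbhs_singleton ma.
have dh j : is_derive x v (fun y => a' j y (B' y)) ('D_v (fun y => a' j y (B' y)) x).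
  by apply/derivableP/diff_derivable; have [] := IH j.
split.
  apply: differentiable_near_eq E _.
  rewrite (_ : (fun _ => _) = \sum_j (fun y => B y 0 j * a' j y (B' y))); last first.
    by apply/funext => y; rewrite fct_sumE.
  apply: differentiable_sum => j; apply: differentiableM; last by have [] := IH j.
  exact: differentiable_mx_entry.
rewrite -(near_eq_derive _ E) -(near_eq_derive _ E').
have -> : 'D_v (fun y => \sum_j B y 0 j * a' j y (B' y)) x =
  \sum_j (B x 0 j * 'D_v (fun y => a' j y (B' y)) x + a' j x (B' x) * 'D_v (fun y => B y 0 j) x).
  rewrite (_ : (fun _ => _) = \sum_j (fun y => B y 0 j * a' j y (B' y))); last first.
    by apply/funext => y; rewrite fct_sumE.
  rewrite derive_sum; last by move=> j; apply: derivableM; [case: (dB0 j)|case: (dh j)].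
  by apply: eq_bigr => j _; rewrite deriveM; [|case: (dB0 j)|case: (dh j)].
have -> : 'D_v (fun y => \sum_j B x 0 j * a' j y (B' x)) x =
  \sum_j (B x 0 j * 'D_v (fun y => a' j y (B' x)) x).
  rewrite (_ : (fun _ => _) = \sum_j (fun y => B x 0 j * a' j y (B' x))); last first.
    by apply/funext => y; rewrite fct_sumE.
  have dd j : derivable (fun y => a' j y (B' x)) x v by apply/diff_derivable/da.
  rewrite derive_sum; last by move=> j; exact: derivableZ.
  by apply: eq_bigr => j _; exact: deriveZ.
rewrite big_ord_recl.
(* The summand of row 0 collects the derivatives of the coefficients [B y 0 j]; the remaining rows
   come from the induction hypothesis. *)
have -> : a x (set_row ord0 ('D_v (fun y => row ord0 (B y)) x) (B x)) =
   \sum_j a' j x (B' x) * 'D_v (fun y => B y 0 j) x.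
  rewrite multilinear_set_row_sum//; apply: eq_bigr => j _.
  rewrite mulrC; congr (_ * _).
    rewrite -[in LHS](@vsubmxK _ 1 k n (B x)); congr (a x _).
    exact: set_row_col_mx0.
  rewrite derive_mx; last first.
    apply: diff_derivable; apply: differentiable_mx => i l.
    by under eq_fun do rewrite mxE; exact: differentiable_mx_entry.
  by rewrite mxE; congr ('D_v _ x); apply/funext => y; rewrite mxE.
have -> : \sum_(i < k) a x (set_row (lift ord0 i) ('D_v (fun y => row (lift ord0 i) (B y)) x) (B x)) =
  \sum_j B x 0 j * \sum_i a' j x (set_row i ('D_v (fun y => row i (B' y)) x) (B' x)).
  under [RHS]eq_bigr do rewrite mulr_sumr.
  rewrite exchange_big/=; apply: eq_bigr => i _.
  rewrite multilinear_first_row//; apply: eq_bigr => j _.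
  rewrite /a' set_rowE/=; congr (_ * a x (@col_mx R 1 k n _ _)).
  apply/matrixP => i' l; rewrite mxE !set_rowE [B' x _ _]mxE.
  have -> : lift ord0 i = @rshift 1 k i by exact: val_inj.
  rewrite (inj_eq (@rshift_inj _ _)); case: ifP => // _.
  suff -> : (fun y => row (@rshift 1 k i) (B y)) = (fun y => row i (B' y)) by [].
  by apply/funext => y; apply/rowP => m; rewrite !mxE.
under eq_bigr => j _ do have [_ ->] := IH j.
rewrite -!big_split; apply: eq_bigr => j _ /=.
by rewrite mulrDr -addrA [X in _ + X]addrC.
Qed.

End MultilinearCalculus.

(** * Alternating forms and permutations of rows *)

Section Alternating.
Context {R : realType}.
Implicit Types k n : nat.

Lemma set_rowC k n (i j : 'I_k) (u w : 'rV[R]_n) A : i != j ->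
  set_row i u (set_row j w A) = set_row j w (set_row i u A).
Proof.
move=> ij; apply/matrixP => p q; rewrite !set_rowE.
by case: (eqVneq p i) => // ->; rewrite (negPf ij).
Qed.

Lemma set_row_id k n (i : 'I_k) (A : 'M[R]_(k, n)) : set_row i (row i A) A = A.
Proof. exact: set_row_row. Qed.

(** Polarisation: expand the vanishing value of the form when rows [i] and [j] are both replaced by
    [row i A + row j A]. *)
Lemma alternating_xrow k n (a : 'M[R]_(k, n) -> R) (i j : 'I_k) A :
  multilinear_rows a -> alternating_rows a -> i != j ->
  a (xrow i j A) = - a A.
Proof.
move=> ma aa ij.
pose b u w := a (set_row i u (set_row j w A)).
have b0 u : b u u = 0.
  by apply: (aa _ _ _ ij); rewrite !row_set_row eqxx eq_sym (negPf ij) eqxx.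
have bDl u w z : b (u + w) z = b u z + b w z by exact: multilinear_set_rowD.
have bDr u w z : b z (u + w) = b z u + b z w.
  by rewrite /b !(set_rowC _ _ _ ij); exact: multilinear_set_rowD.
have /eqP := b0 (row i A + row j A).
rewrite bDl !bDr !b0 add0r addr0 addr_eq0 => /eqP E.
have -> : a A = b (row i A) (row j A) by rewrite /b !set_row_id.
rewrite E opprK; congr a; apply/matrixP => p q.
rewrite !set_rowE !mxE permE/=.
by case: (eqVneq p i) => // _; case: (eqVneq p j).
Qed.

Lemma alternating_row_perm k n (a : 'M[R]_(k, n) -> R) (s : 'S_k) A :
  multilinear_rows a -> alternating_rows a -> a (row_perm s A) = (-1) ^+ s * a A.
Proof.
move=> ma aa; have [ts -> tsP] := prod_tpermP s.
elim: ts A tsP => [|t ts IH] A /=.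
  by rewrite big_nil row_perm1 odd_perm1 mul1r.
move=> /andP[tt /IH {}IH].
rewrite big_cons row_permM odd_permM odd_tperm tt signr_addb -mulrA.
rewrite -IH expr1 mulN1r.
exact: alternating_xrow.
Qed.

(* Moving the common row from position i to position l in the remaining rows
   takes a permutation of sign (-1) ^+ (i + l + 1), namely the one that
   tperm i l induces. *)
Lemma alternating_row'_eq k n (a : 'M[R]_(k, n) -> R) (i l : 'I_k.+1) (A : 'M[R]_(k.+1, n)) :
  multilinear_rows a -> alternating_rows a -> i != l -> row i A = row l A ->
  (-1) ^+ i * a (row' i A) = - ((-1) ^+ l * a (row' l A)).
Proof.
move=> ma aa il eqA.
pose u j := odflt j (unlift l (tperm i l (lift i j))).
have liftu j : lift l (u j) = tperm i l (lift i j).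
  have : tperm i l (lift i j) != l.
    by rewrite -{2}(tpermL i l) (inj_eq perm_inj) eq_sym neq_lift.
  by rewrite /u; case: unliftP => [j' ->//|-> /eqP].
have inj : injective u.
  by move=> j1 j2 /(congr1 (lift l)); rewrite !liftu => /perm_inj/lift_inj.
have U j : lift l (perm inj j) = tperm i l (lift i j) by rewrite permE.
have tE : tperm i l = lift_perm i l (perm inj).
  apply/permP => p; case: (unliftP i p) => [j ->|->].
    by rewrite lift_perm_lift U.
  by rewrite lift_perm_id tpermL.
have -> : row' i A = row_perm (perm inj) (row' l A).
  apply/matrixP => p q; rewrite !mxE U.
  move/rowP/(_ q): eqA; rewrite !mxE.
  by case: tpermP => // ->.
rewrite alternating_row_perm//.
have H : odd i (+) odd l (+) perm inj = true.
  by rewrite -odd_lift_perm -tE odd_tperm il.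
rewrite mulrA -mulNr; congr (_ * _).
rewrite -signr_odd -[in RHS]signr_odd.
by move: H; case: (odd i); case: (odd l); case: (odd_perm _) => //= _; ring.
Qed.

(* This cancels the second derivatives of f in d (f^* a) = f^* (d a). *)
Lemma alternating_symmetric_sum k n (a : 'M[R]_(k, n) -> R) (B : 'M[R]_(k.+1, n))
    (H : 'I_k.+1 -> 'I_k.+1 -> 'rV[R]_n) :
  multilinear_rows a -> alternating_rows a -> (forall i l, H i l = H l i) ->
  \sum_(i < k.+1) (-1) ^+ i * \sum_(j < k) a (set_row j (H i (lift i j)) (row' i B)) = 0.
Proof.
move=> ma aa Hsym.
(* The zero diagonal lets the sum over the [k] remaining rows run over all [l]; the total sum of the
   antisymmetric [K] is then its own opposite. *)
pose K (i l : 'I_k.+1) := if l == i then 0 else (-1) ^+ i * a (row' i (set_row l (H i l) B)).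
have KN i l : K i l = - K l i.
  rewrite /K eq_sym; case: (eqVneq i l) => [_|il]; first by rewrite oppr0.
  have -> : row' i (set_row l (H i l) B) = row' i (set_row i (H i l) (set_row l (H i l) B)).
    by rewrite row'_set_row.
  rewrite (@alternating_row'_eq _ _ a i l)//.
    by rewrite set_rowC// row'_set_row Hsym.
  by rewrite !row_set_row !eqxx eq_sym (negPf il).
have -> : \sum_(i < k.+1) (-1) ^+ i * \sum_(j < k) a (set_row j (H i (lift i j)) (row' i B)) = \sum_i \sum_l K i l.
  apply: eq_bigr => i _; rewrite [RHS](bigD1_ord i)//= {1}/K eqxx add0r mulr_sumr.
  apply: eq_bigr => j _; rewrite /K eq_sym (negPf (neq_lift _ _)).
  congr (_ * a _); apply/matrixP => p q.
  by rewrite set_rowE mxE [RHS]mxE set_rowE (inj_eq lift_inj).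
set S := \sum_i _.
have : S = - S.
  rewrite {1}/S exchange_big -sumrN; apply: eq_bigr => i _.
  by rewrite -sumrN; apply: eq_bigr => l _.
by move/eqP; rewrite -addr_eq0 -mulr2n mulrn_eq0 => /eqP.
Qed.

End Alternating.

(** * Forms in charts *)

Section Charts.
Context {R : realType}.

Lemma jacobianE m n (f : 'rV[R]_m -> 'rV[R]_n) x v : 'd f x v = v *m 'J f x.
Proof. by rewrite /jacobian mul_rV_lin1. Qed.

Lemma eq_mulmx m n (A B : 'M[R]_(m, n)) : (forall u : 'rV[R]_m, u *m A = u *m B) -> A = B.
Proof. by move=> H; apply/row_matrixP => i; rewrite !rowE. Qed.

Lemma jacobian_comp l m n (f : 'rV[R]_l -> 'rV[R]_m) (g : 'rV[R]_m -> 'rV[R]_n) x :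
  differentiable f x -> differentiable g (f x) ->
  'J (g \o f) x = 'J f x *m 'J g (f x).
Proof.
move=> df dg; apply: eq_mulmx => u.
by rewrite mulmxA -!jacobianE diff_comp.
Qed.

Lemma near_eq_jacobian m n (f g : 'rV[R]_m -> 'rV[R]_n) x :
  (\near x, f x = g x) -> differentiable f x -> 'J f x = 'J g x.
Proof.
move=> fg df; apply: eq_mulmx => u.
apply: etrans (esym (jacobianE f x u)) _; apply: etrans _ (jacobianE g x u).
exact: (congr1 (fun h => h u) (diff_near_eq fg df)).
Qed.

Lemma open_chart_image n (M : manifold R n) (c : chart R n M) (D : set M) :
  open D -> open (cmap c @` (cdom c `&` D)).
Proof.
move=> oD; rewrite openE => _ [p [cp Dp] <-].
have xr : (cmap c @` cdom c) (cmap c p) by exists p.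
have H1 : \forall y \near cmap c p, (cmap c @` cdom c) y.
  by apply: open_nbhs_nbhs; split=> //; exact: crange_open.
have H2 : \forall y \near cmap c p, D (cinv c y).
  have := cinv_continuous xr; rewrite /prop_for/= /continuous_at (cmapK cp); apply.
  exact: open_nbhs_nbhs.
apply: filterS2 H1 H2 => _ [q cq <-] /=; rewrite (cmapK cq) => Dq.
by exists q.
Qed.

Lemma smooth_idfun n (M : manifold R n) : smooth_map (idfun : M -> M).
Proof.
split; first by move=> p.
by move=> c c' ac ac'; exact: atlas_compatible.
Qed.

Lemma cdom_preimage_open n m (N : manifold R n) (M : manifold R m) (f : N -> M)
    (D : set M) : smooth_map f -> open D -> open (f @^-1` D).
Proof. by move=> [cf _] oD; apply: open_comp => // p _; exact: cf. Qed.

Lemma near_chart n (M : manifold R n) (c : chart R n M) (D : set M) p : open D ->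
  cdom c p -> D p -> \forall y \near cmap c p, exists2 q, cdom c q /\ D q & y = cmap c q.
Proof.
move=> oD cp Dp.
have H : \forall y \near cmap c p, (cmap c @` (cdom c `&` D)) y.
  by apply: open_nbhs_nbhs; split; [exact: open_chart_image|exists p].
by apply: filterS H => _ [q Dq <-]; exists q.
Qed.

(** The chart expression of [g \o f] factors through [c'] only where [f] lands in the domain of
    [c']; this holds near [cmap c p], which is enough for the Jacobian. With [idfun] for one of the
    maps it becomes the rule for change of chart. *)
Lemma jacobian_chain n m l (N : manifold R n) (M : manifold R m) (P : manifold R l)
    (f : N -> M) (g : M -> P) c c' c'' p :
  smooth_map f -> smooth_map g -> atlas c -> atlas c' -> atlas c'' ->
  cdom c p -> cdom c' (f p) -> cdom c'' (g (f p)) ->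
  'J (cmap c'' \o (g \o f) \o cinv c) (cmap c p) =
  'J (cmap c' \o f \o cinv c) (cmap c p) *m 'J (cmap c'' \o g \o cinv c') (cmap c' (f p)).
Proof.
move=> sf sg ac ac' ac'' cp cfp cgp.
have df : differentiable (cmap c' \o f \o cinv c) (cmap c p).
  by apply: (smooth_on_differentiable (sf.2 _ _ ac ac')); exists p.
have dg : differentiable (cmap c'' \o g \o cinv c') (cmap c' (f p)).
  by apply: (smooth_on_differentiable (sg.2 _ _ ac' ac'')); exists (f p).
have E : (cmap c' \o f \o cinv c) (cmap c p) = cmap c' (f p).
  by rewrite /= (cmapK cp).
rewrite -E in dg *.
apply: etrans (jacobian_comp df dg).
apply/esym/near_eq_jacobian; last exact: differentiable_comp.
have oD := cdom_preimage_open sf (cdom_open c').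
apply: filterS (near_chart oD cp cfp) => _ [q [cq cfq] ->] /=.
by rewrite !(cmapK cq) (cmapK cfq).
Qed.

Lemma jacobian_idfun n (M : manifold R n) (c : chart R n M) p :
  atlas c -> cdom c p -> 'J (cmap c \o cinv c) (cmap c p) = 1%:M.
Proof.
move=> ac cp; apply: eq_mulmx => u; rewrite -jacobianE mulmx1.
have H : \forall y \near cmap c p, id y = (cmap c \o cinv c) y.
  apply: filterS (near_chart openT cp I) => _ [q [cq _] ->] /=.
  by rewrite (cmapK cq).
rewrite -(diff_near_eq H); last by [].
by rewrite diff_val.
Qed.

End Charts.

Section FormsIn.
Context {R : realType} {n : nat} (M : manifold R n).
Implicit Types (c : chart R n M) (p q : M).

Lemma form_inE k (a : kform M k) c p A : cdom c p ->
  form_in a c (cmap c p) A = a p (A *m 'J (cmap (chart_at p) \o cinv c) (cmap c p)).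
Proof. by move=> cp; rewrite /form_in (cmapK cp). Qed.

Lemma form_in_chart_at k (a : kform M k) p A :
  form_in a (chart_at p) (cmap (chart_at p) p) A = a p A.
Proof.
rewrite form_inE; last exact: chart_at_dom.
by rewrite jacobian_idfun ?mulmx1//; [exact: chart_at_atlas|exact: chart_at_dom].
Qed.

(** [vfield_in] and [form_in] use the Jacobians of opposite changes of chart, which are inverse to
    each other. *)
Lemma vfield_inE (X : vfield M) c p : atlas c -> cdom c p ->
  vfield_in X c (cmap c p) *m 'J (cmap (chart_at p) \o cinv c) (cmap c p) = X p.
Proof.
move=> ac cp; rewrite /vfield_in (cmapK cp) -mulmxA.
have := @jacobian_chain _ _ _ _ M M M idfun idfun (chart_at p) c (chart_at p) p
  (smooth_idfun M) (smooth_idfun M) (chart_at_atlas p) ac (chart_at_atlas p)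
  (chart_at_dom p) cp (chart_at_dom p).
rewrite -[_ \o (idfun \o idfun) \o _]/(cmap (chart_at p) \o cinv (chart_at p)).
rewrite jacobian_idfun; [|exact: chart_at_atlas|exact: chart_at_dom].
by move=> /esym E; rewrite [X in _ *m X]E mulmx1.
Qed.

Lemma vfield_in_chart_at (X : vfield M) p :
  vfield_in X (chart_at p) (cmap (chart_at p) p) = X p.
Proof.
rewrite /vfield_in cmapK; last exact: chart_at_dom.
by rewrite jacobian_idfun ?mulmx1//; [exact: chart_at_atlas|exact: chart_at_dom].
Qed.

Lemma form_in_interior k (a : kform M k.+1) (X : vfield M) c p (A : 'M[R]_(k, n)) :
  atlas c -> cdom c p ->
  form_in (interior_prod X a) c (cmap c p) A =
  form_in a c (cmap c p) (col_mx (vfield_in X c (cmap c p)) A).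
Proof.
move=> ac cp; rewrite !form_inE// /interior_prod; congr (a p _).
rewrite -[in LHS](vfield_inE X ac cp).
exact: esym (mul_col_mx (vfield_in X c (cmap c p)) A _).
Qed.

End FormsIn.

(** * Pullbacks in charts *)

Section Pullback.
Context {R : realType} {n m : nat} (N : manifold R n) (M : manifold R m).
Variable f : N -> M.
Hypothesis sf : smooth_map f.

(** Both sides evaluate [a (f p)] on [A] times the Jacobian of [f] from [c] to [chart_at (f p)],
    factored through [chart_at p] on the left and through [c'] on the right. *)
Lemma form_in_pullback k (a : kform M k) c c' p A : atlas c -> atlas c' ->
  cdom c p -> cdom c' (f p) ->
  form_in (pullback f a) c (cmap c p) A =
  form_in a c' (cmap c' (f p)) (A *m 'J (cmap c' \o f \o cinv c) (cmap c p)).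
Proof.
move=> ac ac' cp cfp; rewrite !form_inE// /pullback /tangent_map; congr (a _ _).
rewrite -!mulmxA; congr (_ *m _).
rewrite -[LHS](@jacobian_chain _ _ _ _ N N M idfun f)//; try exact: chart_at_atlas; try exact: chart_at_dom.
  rewrite -[RHS](@jacobian_chain _ _ _ _ N M M f idfun)//; try exact: chart_at_atlas; try exact: chart_at_dom.
  exact: smooth_idfun.
exact: smooth_idfun.
Qed.

End Pullback.

Section MultilinearMul.
Context {R : realType}.

Lemma set_row_mulmx k m n (i : 'I_k) (v : 'rV[R]_m) (A : 'M[R]_(k, m)) (T : 'M[R]_(m, n)) :
  set_row i v A *m T = set_row i (v *m T) (A *m T).
Proof. by apply/row_matrixP => j; rewrite row_mul !row_set_row; case: ifP; rewrite ?row_mul. Qed.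

Lemma multilinear_mulmx k m n (a : 'M[R]_(k, n) -> R) (T : 'M[R]_(m, n)) :
  multilinear_rows a -> multilinear_rows (fun A => a (A *m T)).
Proof.
move=> /multilinear_rowsP H; apply/multilinear_rowsP => i A u w b c.
by rewrite !set_row_mulmx mulmxDl -!scalemxAl H.
Qed.

Lemma alternating_mulmx k m n (a : 'M[R]_(k, n) -> R) (T : 'M[R]_(m, n)) :
  alternating_rows a -> alternating_rows (fun A => a (A *m T)).
Proof. by move=> H A i j ij E; apply: (H _ _ _ ij); rewrite !row_mul E. Qed.

Lemma alternating_col_mx k n (a : 'M[R]_(1 + k, n) -> R) u :
  alternating_rows a -> alternating_rows (fun A => a (col_mx u A)).
Proof.
move=> H A i j ij /rowP E; apply: (H _ (rshift 1 i) (rshift 1 j)).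
  by rewrite (inj_eq (@rshift_inj _ _)).
by apply/rowP => l; have := E l; rewrite !mxE !(unsplitK (inr _)).
Qed.

End MultilinearMul.

(** * Smoothness of interior and exterior products *)

Section SmoothForms.
Context {R : realType} {n : nat} (M : manifold R n).
Implicit Types (D : set M) (k l : nat).

Lemma form_in_multilinear k (a : kform M k) c p : cdom c p ->
  multilinear_rows (a p) -> multilinear_rows (form_in a c (cmap c p)).
Proof.
move=> cp H; rewrite /form_in (cmapK cp); exact: multilinear_mulmx.
Qed.

Lemma form_in_alternating k (a : kform M k) c p : cdom c p ->
  alternating_rows (a p) -> alternating_rows (form_in a c (cmap c p)).
Proof.
move=> cp H; rewrite /form_in (cmapK cp); exact: alternating_mulmx.
Qed.

Lemma smooth_form_onS D D' k (a : kform M k) :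
  D' `<=` D -> smooth_form_on D a -> smooth_form_on D' a.
Proof.
move=> DD [H1 H2]; split=> [p /DD/H1//|c A ac r].
apply: Cn_onS (H2 c A ac r) => _ [p [cp Dp] <-]; exists p => //; split=> //; exact: DD.
Qed.

Lemma smooth_interior D k (a : kform M k.+1) (X : vfield M) : open D ->
  smooth_form_on D a -> smooth_vfield_on D X -> smooth_form_on D (interior_prod X a).
Proof.
move=> oD [ma sa] sX; split=> [p /ma[m1 m2]|c A ac r].
  by split; [exact: (@multilinear_col_mx _ k)|exact: (@alternating_col_mx _ k)].
have oE : open (cmap c @` (cdom c `&` D)) by exact: open_chart_image.
have H : Cn_on r (cmap c @` (cdom c `&` D))
    (fun x => form_in a c x (col_mx (vfield_in X c x) A)).
  apply: (Cn_on_multilinear (a := form_in a c)) => //.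
  - by move=> _ [p [cp Dp] <-]; apply: form_in_multilinear => //; have [] := ma p Dp.
  - by move=> B; exact: sa.
  - apply/Cn_on_mx => // i j.
    have [i' E|i' E] := @splitP 1 k i.
      have -> : i = @lshift 1 k i' by exact: val_inj.
      apply: Cn_on_ext oE _ ((Cn_on_mx r _ oE).1 (sX c ac r) 0 j) => x _.
      by rewrite (ord1 i'); exact: esym (col_mxEu (vfield_in X c x) A _ _).
    have -> : i = @rshift 1 k i' by exact: val_inj.
    apply: Cn_on_ext oE _ (Cn_on_cst r _ (A i' j)) => x _.
    exact: esym (col_mxEd (vfield_in X c x) A _ _).
apply: Cn_on_ext oE _ H => _ [p [cp Dp] <-].
by rewrite form_in_interior.
Qed.

Lemma smooth_formN D k (a : kform M k) : open D ->
  smooth_form_on D a -> smooth_form_on D (fun p A => - a p A).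
Proof.
move=> oD [ma sa]; split=> [p /ma[/multilinear_rowsP m1 m2]|c A ac r].
  split; last by move=> A i j ij E; rewrite (m2 _ _ _ ij E) oppr0.
  by apply/multilinear_rowsP => i A u w b c; rewrite m1 opprD !mulrN.
by apply: Cn_onN; [exact: open_chart_image|exact: sa].
Qed.

Lemma row_perm_set_row k (s : 'S_k) (i : 'I_k) (v : 'rV[R]_n) A :
  row_perm s (set_row (s i) v A) = set_row i v (row_perm s A).
Proof.
by apply/matrixP => p q; rewrite mxE !set_rowE (inj_eq perm_inj) mxE.
Qed.

Lemma usubmx_set_row k l (i : 'I_(k + l)) (v : 'rV[R]_n) A :
  usubmx (set_row i v A) = if fintype.split i is inl j then set_row j v (usubmx A) else usubmx A.
Proof.
apply/matrixP => p q; rewrite mxE set_rowE.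
case: splitP => j E; rewrite ?set_rowE !mxE -val_eqE /= E //.
by rewrite ltn_eqF// (leq_trans (ltn_ord p)) ?leq_addr.
Qed.

Lemma dsubmx_set_row k l (i : 'I_(k + l)) (v : 'rV[R]_n) A :
  dsubmx (set_row i v A) = if fintype.split i is inr j then set_row j v (dsubmx A) else dsubmx A.
Proof.
apply/matrixP => p q; rewrite mxE set_rowE.
case: splitP => j E; rewrite ?set_rowE !mxE -val_eqE /= E ?eqn_add2l //.
by rewrite gtn_eqF// (leq_trans (ltn_ord j)) ?leq_addr.
Qed.

Lemma multilinear_ext_prod k l (a : 'M[R]_(k, n) -> R) (b : 'M[R]_(l, n) -> R) :
  multilinear_rows a -> multilinear_rows b -> multilinear_rows (ext_prod a b).
Proof.
move=> /multilinear_rowsP ma /multilinear_rowsP mb.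
apply/multilinear_rowsP => i A u w x y; rewrite /ext_prod.
rewrite !(mulrCA _ _^-1) -mulrDr; congr (_ * _).
rewrite !mulr_sumr -big_split; apply: eq_bigr => s _ /=.
(* Row [i] becomes row [s^-1 i] of the permuted matrix, so it enters either the argument of [a] or
   that of [b], and only one of them. *)
have -> : i = s ((s^-1)%g i) by rewrite permKV.
rewrite !row_perm_set_row !usubmx_set_row !dsubmx_set_row.
by set e := (-1) ^+ _; case: (fintype.split _) => j; rewrite ?ma ?mb; ring.
Qed.

(** Replacing [s] by [s * tperm i j] changes every sign but, the two rows being equal, not the
    permuted matrix; so the sum is its own opposite, whatever [a] and [b] are. *)
Lemma alternating_ext_prod k l (a : 'M[R]_(k, n) -> R) (b : 'M[R]_(l, n) -> R) :
  alternating_rows (ext_prod a b).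
Proof.
move=> A i j ij E; rewrite /ext_prod.
set S := \sum_s _; suff : S = - S.
  by move/eqP; rewrite -addr_eq0 -mulr2n mulrn_eq0 => /eqP ->; rewrite mulr0.
rewrite {1}/S (reindex_inj (mulIg (tperm i j))) -sumrN.
apply: eq_bigr => s _; rewrite odd_permM odd_tperm ij.
have -> : row_perm (s * tperm i j) A = row_perm s A.
  apply/matrixP => p q; rewrite !mxE permM.
  by move/rowP/(_ q): E; rewrite !mxE => E; case: tpermP => // ->.
by rewrite signr_addb expr1 mulrN1 !mulNr.
Qed.

Lemma form_in_wedge k l (a : kform M k) (b : kform M l) c x A :
  form_in (wedge a b) c x A = ext_prod (form_in a c x) (form_in b c x) A.
Proof.
rewrite /form_in /wedge /ext_prod; congr (_ * _); apply: eq_bigr => s _.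
set J := 'J _ _.
have -> : row_perm s (A *m J) = row_perm s A *m J by rewrite !row_permE mulmxA.
by rewrite -mul_usub_mx -mul_dsub_mx.
Qed.

Lemma smooth_wedge D k l (a : kform M k) (b : kform M l) : open D ->
  smooth_form_on D a -> smooth_form_on D b -> smooth_form_on D (wedge a b).
Proof.
move=> oD [ma sa] [mb sb]; split=> [p Dp|c A ac r].
  split; last exact: alternating_ext_prod.
  by apply: multilinear_ext_prod; [have [] := ma p Dp|have [] := mb p Dp].
have oE : open (cmap c @` (cdom c `&` D)) by exact: open_chart_image.
under eq_fun do rewrite form_in_wedge /ext_prod.
apply: (Cn_onM oE); first exact: Cn_on_cst.
apply: (Cn_on_sum _ _ oE) => s; apply: (Cn_onM oE); last exact: sb.
by apply: (Cn_onM oE); [exact: Cn_on_cst|exact: sa].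
Qed.

End SmoothForms.

Section PullbackSmooth.
Context {R : realType} {n m : nat} (N : manifold R n) (M : manifold R m).
Variable f : N -> M.
Hypothesis sf : smooth_map f.

Let phi (c : chart R n N) (c' : chart R m M) := cmap c' \o f \o cinv c.

Lemma smooth_loc c c' : atlas c -> atlas c' ->
  smooth_on (cmap c @` (cdom c `&` f @^-1` cdom c')) (phi c c').
Proof. exact: sf.2. Qed.

Lemma open_loc (c : chart R n N) (c' : chart R m M) D : open D ->
  open (cmap c @` (cdom c `&` f @^-1` (cdom c' `&` D))).
Proof.
move=> oD; apply/open_chart_image/cdom_preimage_open => //.
by apply: openI => //; exact: cdom_open.
Qed.

Lemma smooth_pullback D k (a : kform M k) : open D -> (forall p, D (f p)) ->
  smooth_form_on D a -> smooth_form (pullback f a).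
Proof.
move=> oD Df [ma sa]; split=> [p _|c A ac r].
  by have [m1 m2] := ma _ (Df p); split; [exact: multilinear_mulmx|exact: alternating_mulmx].
(* A single chart [c'] of M is known to contain the image only near [p], so smoothness is checked
   locally. *)
apply: Cn_on_local => _ [p [cp _] <-].
set c' := chart_at (f p).
have ac' : atlas c' by exact: chart_at_atlas.
pose E := cmap c @` (cdom c `&` f @^-1` (cdom c' `&` D)).
have oE : open E by exact: open_loc.
exists E; first by exists p => //; split => //; split; [exact: chart_at_dom|exact: Df].
have sphi : smooth_on E (phi c c').
  move=> r'; apply: Cn_onS (smooth_loc ac ac' r') => _ [q [cq [cfq _]] <-].
  by exists q.
have H : Cn_on r E (fun x => form_in a c' (phi c c' x) (A *m 'J (phi c c') x)).
  apply: (Cn_on_multilinear (a := fun x => form_in a c' (phi c c' x))) => //.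
  - move=> _ [q [cq [cfq _]] <-]; rewrite /phi /= (cmapK cq).
    by apply: form_in_multilinear => //; have [] := ma _ (Df q).
  - move=> B; apply: (@Cn_on_comp_real _ _ _ _ _ (cmap c' @` (cdom c' `&` D)) (phi c c') (fun y => form_in a c' y B)) => //; last exact: sa.
    by move=> _ [q [cq [cfq Dq]] <-]; rewrite /phi /= (cmapK cq); exists (f q).
  - have oE' := (Cn_on_mx r _ oE).1 (Cn_on_jacobian oE (sphi r.+1)).
    apply/Cn_on_mx => // i j; under eq_fun do rewrite mxE.
    apply: (Cn_on_sum _ _ oE) => l; apply: (Cn_onM oE); first exact: Cn_on_cst.
    exact: oE'.
apply: Cn_on_ext oE _ H => _ [q [cq [cfq _]] <-].
have -> : phi c c' (cmap c q) = cmap c' (f q) by rewrite /phi /= (cmapK cq).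
exact: esym (form_in_pullback sf a A ac ac' cq cfq).
Qed.

End PullbackSmooth.

(** * Exterior derivative *)

Lemma derive_comp (R : realType) (U V W : normedModType R) (f : U -> V) (g : V -> W) x v :
  differentiable f x -> differentiable g (f x) ->
  'D_v (fun y => g (f y)) x = 'D_('d f x v) g (f x).
Proof.
move=> df dg; apply: etrans (deriveE _ _) _; first exact: (differentiable_comp df dg).
by rewrite [LHS](congr1 (fun h => h v) (diff_comp df dg)) /= deriveE.
Qed.

Lemma derive_diffC (R : realType) (U : normedModType R) m (phi : U -> 'rV[R]_m) E x v w :
  open E -> E x -> smooth_on E phi ->
  'D_v (fun y => 'd phi y w) x = 'D_w (fun y => 'd phi y v) x.
Proof.
move=> oE Ex sphi.
have nE : \forall y \near x, E y by exact: open_nbhs_nbhs.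
have dd u : differentiable (fun y => 'd phi y u) x.
  by apply: smooth_on_differentiable Ex; exact: smooth_on_diff.
rewrite !derive_mx; [|exact: diff_derivable..].
apply/rowP => j; rewrite !mxE.
pose g y := phi y 0 j.
have sg : smooth_on E g by move=> r; exact: (Cn_on_mx r _ oE).1 (sphi r) 0 j.
have H u u' : 'D_u (fun y => 'd phi y u' 0 j) x = 'd (fun y => 'd g y u') x u.
  rewrite -deriveE; last by apply: smooth_on_differentiable Ex; exact: smooth_on_diff.
  apply: near_eq_derive; apply: filterS nE => y Ey.
  by rewrite diff_mx_entry//; exact: smooth_on_differentiable Ey.
rewrite !H; apply: young.
- by apply: filterS nE => y Ey; exact: smooth_on_differentiable Ey.
- by apply: smooth_on_differentiable Ex; exact: smooth_on_diff.
- by apply: smooth_on_differentiable Ex; exact: smooth_on_diff.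
Qed.

Section ExtDPullback.
Context {R : realType} {n m : nat} (N : manifold R n) (M : manifold R m).
Variable f : N -> M.
Hypothesis sf : smooth_map f.

(** In charts the pullback at [y] is the form at [phi y] evaluated on [B *m J y]. By the product
    rule, differentiating the coefficients gives the pullback of da, while differentiating [J] gives
    Hessian terms, which [alternating_symmetric_sum] removes. *)
Lemma ext_d_pullback (D : set M) k (a : kform M k) p A : open D -> D (f p) ->
  smooth_form_on D a ->
  ext_d (pullback f a) p A = pullback f (ext_d a) p A.
Proof.
move=> oD Dfp [ma sa].
set c := chart_at p; set c' := chart_at (f p).
have ac : atlas c by exact: chart_at_atlas.
have ac' : atlas c' by exact: chart_at_atlas.
have cp : cdom c p by exact: chart_at_dom.
have cfp : cdom c' (f p) by exact: chart_at_dom.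
pose phi := cmap c' \o f \o cinv c.
pose x := cmap c p.
pose E := cmap c @` (cdom c `&` f @^-1` (cdom c' `&` D)).
have oE : open E by exact: open_loc.
have Ex : E x by exists p.
have sphi : smooth_on E phi.
  by move=> r'; apply: Cn_onS (smooth_loc sf ac ac' r') => _ [q [cq [cfq _]] <-]; exists q.
have phix : phi x = cmap c' (f p) by rewrite /phi /= (cmapK cp).
have dphi : differentiable phi x by exact: smooth_on_differentiable sphi Ex.
have nE : \forall y \near x, E y by exact: open_nbhs_nbhs.
(* J is made opaque because conversion between two Jacobians, which unfolds
   the choice operator behind 'd, may not terminate. *)
have [J JE] : exists J, J = fun y => 'J phi y by exists (fun y => 'J phi y).
have JE' y : J y = 'J phi y by rewrite JE.
pose T := J x.
pose a' y := form_in a c' (phi y).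
have mnear : \forall y \near x, multilinear_rows (a' y).
  apply: filterS nE => _ [q [cq [cfq Dq]] <-]; rewrite /a' /phi /= (cmapK cq).
  by apply: form_in_multilinear => //; have [] := ma _ Dq.
have dform B : differentiable (fun y => form_in a c' y B) (phi x).
  by apply: (smooth_on_differentiable (sa c' B ac')); rewrite phix; exists (f p).
have da' B : differentiable (fun y => a' y B) x.
  exact: (@differentiable_comp _ _ _ _ phi (fun y => form_in a c' y B)).
have dJ B : differentiable (fun y => B *m J y : 'M[R]_(k, m)) x.
  apply: differentiable_mx => i j; under eq_fun do rewrite mxE.
  rewrite (_ : (fun _ => _) = \sum_l (fun y => B i l *: (J y l j : R))); last first.
    by apply/funext => y; rewrite fct_sumE.
  apply: differentiable_sum => l; apply: differentiableZ.
  have H : Cn_on 1 E (fun y => J y l j).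
    rewrite JE.
    by apply: (Cn_on_mx 1 _ oE).1; apply: Cn_on_jacobian => //; exact: sphi.
  by case: H => + _; exact.
have axE : a' x = form_in a c' (cmap c' (f p)) by rewrite /a' phix.
rewrite /pullback /ext_d -/c -/c' -/x.
have -> : tangent_map f p = T by rewrite /T JE'.
have step (i : 'I_k.+1) :
   'D_(row i A) (fun y => form_in (pullback f a) c y (row' i A)) x =
   'D_(row i (A *m T)) (fun y => form_in a c' y (row' i (A *m T))) (cmap c' (f p)) +
   \sum_(j < k) a' x (set_row j ('D_(row i A) (fun y => row j (row' i A *m J y)) x) (row' i (A *m T))).
  have H : \forall y \near x, a' y (row' i A *m J y) = form_in (pullback f a) c y (row' i A).
    apply: filterS nE => _ [q [cq [cfq Dq]] <-].
    rewrite /a' (_ : phi (cmap c q) = cmap c' (f q)); last by rewrite /phi/= (cmapK cq).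
    rewrite JE'; exact: esym (form_in_pullback sf a _ ac ac' cq cfq).
  rewrite -(near_eq_derive _ H).
  have [_ ->] := derive_multilinear (row i A) mnear da' (dJ (row' i A)).
  have Bx : row' i A *m J x = row' i (A *m T).
    by apply/matrixP => u v; rewrite !mxE; apply: eq_bigr => l _; rewrite mxE.
  rewrite Bx.
  have -> : 'D_(row i A) (fun y => a' y (row' i (A *m T))) x =
      'D_(row i (A *m T)) (fun y => form_in a c' y (row' i (A *m T))) (cmap c' (f p)).
    apply: etrans (derive_comp (g := fun y => form_in a c' y (row' i (A *m T))) _ dphi (dform _)) _.
    by rewrite phix row_mul /T JE' -jacobianE.
  by [].
under eq_bigr do rewrite step mulrDr.
rewrite big_split/= -[RHS]addr0; congr (_ + _).
have Hs (i : 'I_k.+1) (j : 'I_k) :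
  (fun y => row j (row' i A *m J y)) = (fun y => row (lift i j) A *m J y).
  by apply/funext => y; rewrite row_mul; congr (_ *m _); apply/rowP => l; rewrite !mxE.
under eq_bigr do under eq_bigr do rewrite Hs.
have [max aax] : multilinear_rows (a' x) /\ alternating_rows (a' x).
  rewrite axE; have [] := ma _ Dfp.
  by split; [exact: form_in_multilinear|exact: form_in_alternating].
pose H i l := 'D_(row i A) (fun y => row l A *m J y) x.
(* [H i l] is the second derivative of [phi] along rows [i] and [l] of [A]. *)
have Hsym i l : H i l = H l i.
  have JD B : (fun y => B *m J y) = (fun y => 'd phi y B).
    by apply/funext => y; rewrite JE' jacobianE.
  by rewrite /H !JD; exact: derive_diffC sphi.
exact: alternating_symmetric_sum (A *m T) _ max aax Hsym.
Qed.

End ExtDPullback.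

(** * Matrices with a row put on top *)

Section ConsRow.
Context {R : comNzRingType}.
Implicit Types k n : nat.
Notation cons_mx u A := (@col_mx _ 1 _ _ u A).

Lemma cons_mx0 k n (u : 'rV[R]_n) (A : 'M[R]_(k, n)) j :
  (cons_mx u A : 'M[R]_(k.+1, n)) ord0 j = u 0 j.
Proof.
have -> : (ord0 : 'I_k.+1) = @lshift 1 k ord0 by exact: val_inj.
exact: col_mxEu.
Qed.

Lemma cons_mxS k n (u : 'rV[R]_n) (A : 'M[R]_(k, n)) i j :
  (cons_mx u A : 'M[R]_(k.+1, n)) (lift ord0 i) j = A i j.
Proof.
have -> : lift ord0 i = @rshift 1 k i by exact: val_inj.
exact: col_mxEd.
Qed.

Lemma row_cons_mx0 k n (u : 'rV[R]_n) (A : 'M[R]_(k, n)) :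
  row (ord0 : 'I_k.+1) (cons_mx u A) = u.
Proof. by apply/rowP => j; rewrite mxE cons_mx0. Qed.

Lemma row_cons_mxS k n (u : 'rV[R]_n) (A : 'M[R]_(k, n)) i :
  row (lift ord0 i : 'I_k.+1) (cons_mx u A) = row i A.
Proof. by apply/rowP => j; rewrite mxE cons_mxS [RHS]mxE. Qed.

Lemma row'_cons_mx0 k n (u : 'rV[R]_n) (A : 'M[R]_(k, n)) :
  row' (ord0 : 'I_k.+1) (cons_mx u A) = A.
Proof. by apply/matrixP => i j; rewrite mxE cons_mxS. Qed.

Lemma row'_cons_mxS k n (u : 'rV[R]_n) (A : 'M[R]_(k.+1, n)) i :
  row' (lift ord0 i : 'I_k.+2) (cons_mx u A) = cons_mx u (row' i A).
Proof.
apply/matrixP => p j; rewrite mxE.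
case: (unliftP (ord0 : 'I_k.+1) p) => [p'|] ->.
  rewrite [RHS]cons_mxS [RHS]mxE.
  have -> : lift (lift ord0 i) (lift ord0 p') = lift ord0 (lift i p').
    by apply: val_inj; rewrite /= /bump /= !add1n ltnS addnS.
  exact: cons_mxS.
rewrite [RHS]cons_mx0.
have -> : lift (lift ord0 i) (ord0 : 'I_k.+1) = ord0 by exact: val_inj.
exact: cons_mx0.
Qed.

End ConsRow.

(** * Cartan's formula *)

Section Cartan.
Context {R : realType} {n : nat} (M : manifold R n).

(** [C] carries [w] both on top and in row [i + 1]; omitting the one or the other gives the two
    sides. *)
Lemma alternating_set_row k (a : 'M[R]_(k.+1, n) -> R) (i : 'I_k.+1) w (A : 'M[R]_(k.+1, n)) :
  multilinear_rows a -> alternating_rows a ->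
  a (set_row i w A) = (-1) ^+ i * a (@col_mx R 1 k n w (row' i A)).
Proof.
move=> ma aa.
pose C : 'M[R]_(k.+2, n) := @col_mx R 1 k.+1 n w (set_row i w A).
have E : row ord0 C = row (lift ord0 i) C.
  by rewrite row_cons_mx0 row_cons_mxS row_set_row eqxx.
have := alternating_row'_eq ma aa (neq_lift ord0 i) E.
rewrite expr0 mul1r exprS mulN1r mulNr opprK.
by rewrite row'_cons_mx0 row'_cons_mxS row'_set_row.
Qed.

(** In d(i_X a) the product rule gives derivatives of [a] with [X] fixed in the first slot, and
    values of [a] on the derivatives of [X]. The former cancel against all terms of da(X, ...) but
    the one differentiating along [X]; the latter, moved from the first slot to slot [i], are the
    bracket terms of the Lie derivative. *)
Lemma cartan (D : set M) k (a : kform M k.+1) (X : vfield M) q (A : 'M[R]_(k.+1, n)) :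
  open D -> D q -> smooth_form_on D a -> smooth_vfield_on D X ->
  lie_derivative X a q A =
    ext_d (interior_prod X a) q A + ext_d a q (@col_mx R 1 k.+1 n (X q) A).
Proof.
move=> oD Dq [ma sa] sX.
set c := chart_at q.
have ac : atlas c by exact: chart_at_atlas.
have cq : cdom c q by exact: chart_at_dom.
pose x := cmap c q.
pose E := cmap c @` (cdom c `&` D).
have oE : open E by exact: open_chart_image.
have Ex : E x by exists q.
have nE : \forall y \near x, E y by exact: open_nbhs_nbhs.
have mnear : \forall y \near x, multilinear_rows (form_in a c y).
  by apply: filterS nE => _ [p [cp Dp] <-]; apply: form_in_multilinear => //; have [] := ma p Dp.
have da B : differentiable (fun y => form_in a c y B) x.
  by apply: (smooth_on_differentiable (sa c B ac)).
have dX : differentiable (vfield_in X c) x by apply: (smooth_on_differentiable (sX c ac)).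
have Xq : vfield_in X c x = X q by exact: vfield_in_chart_at.
have [max aax] : multilinear_rows (form_in a c x) /\ alternating_rows (form_in a c x).
  have [m1 m2] := ma _ Dq.
  by split; [exact: form_in_multilinear|exact: form_in_alternating].
rewrite /lie_derivative /ext_d -/c -/x Xq.
pose cB (B : 'M[R]_(k, n)) (y : 'rV[R]_n) := @col_mx R 1 k n (vfield_in X c y) B.
have dB B : differentiable (cB B) x.
  apply: differentiable_mx => i j.
  case: (unliftP (ord0 : 'I_k.+1) i) => [i'|] ->.
    rewrite (_ : (fun _ => _) = cst (B i' j)); first exact: differentiable_cst.
    by apply/funext => y; exact: cons_mxS.
  rewrite (_ : (fun _ => _) = (fun y => vfield_in X c y 0 j)).
    exact: differentiable_mx_entry.
  by apply/funext => y; exact: cons_mx0.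
have step (i : 'I_k.+1) :
  'D_(row i A) (fun y => form_in (interior_prod X a) c y (row' i A)) x =
  'D_(row i A) (fun y => form_in a c y (@col_mx R 1 k n (X q) (row' i A))) x +
  form_in a c x (@col_mx R 1 k n ('D_(row i A) (vfield_in X c) x) (row' i A)).
  have H : \forall y \near x, form_in a c y (cB (row' i A) y) = form_in (interior_prod X a) c y (row' i A).
    by apply: filterS nE => _ [p [cp Dp] <-]; rewrite form_in_interior.
  rewrite -(near_eq_derive _ H).
  have [_ ->] := derive_multilinear (row i A) mnear da (dB (row' i A)).
  have cBx : cB (row' i A) x = @col_mx R 1 k n (X q) (row' i A) by rewrite /cB Xq.
  rewrite cBx; congr (_ + _).
  rewrite big_ord_recl big1 ?addr0; last first.
    move=> j _.
    have -> : (fun y => row (lift ord0 j) (cB (row' i A) y)) = cst (row j (row' i A)).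
      by apply/funext => y; exact: row_cons_mxS.
    by rewrite derive_cst; exact: multilinear_set_row0.
  have -> : (fun y => row ord0 (cB (row' i A) y)) = vfield_in X c.
    by apply/funext => y; exact: row_cons_mx0.
  by rewrite set_row_col_mx0.
under [in RHS]eq_bigr do rewrite step mulrDr.
rewrite big_split/= [X in _ = _ + X]big_ord_recl.
rewrite row_cons_mx0 row'_cons_mx0 expr0 mul1r.
under [X in _ = _ + (_ + X)]eq_bigr do
  rewrite row_cons_mxS row'_cons_mxS exprS mulN1r mulNr.
rewrite sumrN addrC [X in _ = _ + X]addrC addrA [X in _ = X + _]addrAC.
rewrite subrK addrC; congr (_ + _).
by apply: eq_bigr => i _; rewrite -alternating_set_row.
Qed.

End Cartan.

(** * Exterior products *)

Section ExtProd.
Context {R K : numFieldType} {n : nat}.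
Implicit Types k l : nat.
Notation cons_mx u A := (@col_mx _ 1 _ _ u A).

Lemma sum_lift_perm k (j0 : 'I_k.+1) (F : 'S_k.+1 -> K) :
  \sum_s F s = \sum_i \sum_(t : 'S_k) F (lift_perm j0 i t).
Proof.
pose h (p : 'I_k.+1 * 'S_k) := lift_perm j0 p.1 p.2.
have hinj : injective h.
  move=> [i t] [i' t'] /permP E.
  have ii' : i = i' by have := E j0; rewrite /h !lift_perm_id.
  congr (_, _) => //; apply/permP => q; have := E (lift j0 q).
  by rewrite /h /= !lift_perm_lift ii' => /lift_inj.
have hbij : bijective h.
  by apply: (inj_card_bij hinj); rewrite card_prod card_ord !card_Sn.
by rewrite (reindex h) ?pair_big//=; exact: onW_bij.
Qed.

(** The exterior product without its factor 1/(k! l!), which would change along the recursion on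
    [k]. *)
Definition ext_prod_sum k l (a : 'M[R]_(k, n) -> K) (b : 'M[R]_(l, n) -> K) A :=
  \sum_(s : 'S_(k + l)) (-1) ^+ s * a (usubmx (row_perm s A)) * b (dsubmx (row_perm s A)).

Lemma row_perm_lift0 k (i : 'I_k.+1) (t : 'S_k) (A : 'M[R]_(k.+1, n)) :
  row_perm (lift_perm ord0 i t) A = cons_mx (row i A) (row_perm t (row' i A)).
Proof.
apply/row_matrixP => p.
case: (unliftP ord0 p) => [q|] ->.
  by rewrite row_cons_mxS; apply/rowP => j; rewrite !mxE lift_perm_lift.
by rewrite row_cons_mx0; apply/rowP => j; rewrite !mxE lift_perm_id.
Qed.

(* The permutations s are sorted by i = s 0. *)
Lemma ext_prod_sum_rec k l (a : 'M[R]_(k.+1, n) -> K) (b : 'M[R]_(l, n) -> K) A :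
  @ext_prod_sum k.+1 l a b A =
  \sum_(i < (k + l).+1) (-1) ^+ i *
    @ext_prod_sum k l (fun B => a (cons_mx (row i A) B)) b (row' i A).
Proof.
rewrite /ext_prod_sum (sum_lift_perm ord0); apply: eq_bigr => i _.
rewrite mulr_sumr; apply: eq_bigr => t _; rewrite row_perm_lift0 !mulrA.
congr (_ * _ * _).
- rewrite -[(-1) ^+ i]signr_odd -signr_addb.
  by congr (_ ^+ nat_of_bool _); exact: odd_lift_perm.
- congr a; apply/row_matrixP => p; case: (unliftP ord0 p) => [q|] ->.
    rewrite row_cons_mxS; apply/rowP => j; rewrite [LHS]mxE [LHS]mxE [RHS]mxE [RHS]mxE.
    have -> : @lshift k.+1 l (lift ord0 q) = lift ord0 (@lshift k l q) by exact: val_inj.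
    exact: cons_mxS.
  rewrite row_cons_mx0; apply/rowP => j; rewrite [LHS]mxE [LHS]mxE.
  have -> : @lshift k.+1 l ord0 = ord0 by exact: val_inj.
  exact: cons_mx0.
- congr b; apply/matrixP => p j; rewrite [LHS]mxE [RHS]mxE.
  have -> : @rshift k.+1 l p = lift ord0 (@rshift k l p) by exact: val_inj.
  exact: cons_mxS.
Qed.

(** Once the slots of [a] are used up, all permutations contribute equally, whence the l! that the
    normalisation cancels. The sign rule for [b] is assumed directly because values lie in [K]; in
    degree 1 any function satisfies it. *)
Lemma ext_prod_sum0 l (a : 'M[R]_(0, n) -> K) (b : 'M[R]_(l, n) -> K) (B : 'M[R]_(l, n)) :
  (forall s : 'S_l, b (row_perm s B) = (-1) ^+ s * b B) ->
  @ext_prod_sum 0 l a b B = l`!%:R * (a 0 * b B).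
Proof.
move=> hb; have -> : l`!%:R * (a 0 * b B) = \sum_(s : 'S_l) a 0 * b B.
  by rewrite sumr_const card_Sn mulr_natl.
apply: eq_bigr => s _; rewrite (flatmx0 (usubmx _)).
have -> : dsubmx (row_perm s B) = row_perm s B.
  by apply/matrixP => i j; rewrite [LHS]mxE; congr (row_perm s B _ j); exact: val_inj.
by rewrite hb mulrACA -expr2 sqrr_sign mul1r.
Qed.

Lemma ext_prod1 l (a : 'M[R]_(1, n) -> K) (b : 'M[R]_(l, n) -> K) (A : 'M[R]_(1 + l, n)) :
  (forall B (s : 'S_l), b (row_perm s B) = (-1) ^+ s * b B) ->
  ext_prod a b A = \sum_(i < l.+1) (-1) ^+ i * (a (row i A) * b (row' i A)).
Proof.
move=> hb; rewrite /ext_prod -/(ext_prod_sum a b A) (@ext_prod_sum_rec 0).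
rewrite mulr_sumr; apply: eq_bigr => i _.
rewrite (ext_prod_sum0 _ (hb _)) mulrCA mul1n mulKf; last by rewrite pnatr_eq0 -lt0n fact_gt0.
congr (_ * (a _ * _)); apply/matrixP => p j.
by rewrite (ord1 p); exact: cons_mx0.
Qed.

Lemma ext_prod2 l (a : 'M[R]_(2, n) -> K) (b : 'M[R]_(l, n) -> K) (A : 'M[R]_(2 + l, n)) :
  (forall B (s : 'S_l), b (row_perm s B) = (-1) ^+ s * b B) ->
  2 * ext_prod a b A = \sum_(i < l.+2) \sum_(j < l.+1) (-1) ^+ i * ((-1) ^+ j *
     (a (cons_mx (row i A) (row j (row' i A))) * b (row' j (row' i A)))).
Proof.
move=> hb; rewrite /ext_prod -/(ext_prod_sum a b A) (@ext_prod_sum_rec 1).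
rewrite mulrA natrM invfM mulrA divff ?pnatr_eq0// mul1r mulr_sumr.
apply: eq_bigr => i _.
rewrite (@ext_prod_sum_rec 0) mulrCA !mulr_sumr; apply: eq_bigr => j _.
rewrite (ext_prod_sum0 _ (hb _)).
rewrite [_^-1 * _]mulrCA mulKf; last by rewrite pnatr_eq0 -lt0n fact_gt0.
congr (_ * (_ * (a _ * _))); apply/row_matrixP => p.
case: (unliftP (ord0 : 'I_2) p) => [q|] ->; last by rewrite !row_cons_mx0.
rewrite !row_cons_mxS; apply/rowP => m; rewrite [LHS]mxE [RHS]mxE.
by rewrite (ord1 q); exact: cons_mx0.
Qed.

Lemma perm_sign1 (b : 'M[R]_(1, n) -> K) B (s : 'S_1) : b (row_perm s B) = (-1) ^+ s * b B.
Proof.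
have -> : s = 1%g by apply/permP => i; rewrite !ord1.
by rewrite row_perm1 odd_perm1 expr0 mul1r.
Qed.

End ExtProd.

(** * Exterior products of low degree on explicit vectors *)

Section ExplicitExtProd.
Context {R K : numFieldType} {n : nat}.
Notation cons_mx u A := (@col_mx _ 1 _ _ u A).

(* Indexing by nat lets the indices of iterated row' compute; nrow A i is
   row 0 of A when i is out of range. *)
Definition nrow k (A : 'M[R]_(k.+1, n)) (i : nat) : 'rV[R]_n := row (inord i) A.

Definition mx2 (u v : 'rV[R]_n) : 'M[R]_(2, n) := col_mx u v.

Lemma row_nrow k (A : 'M[R]_(k.+1, n)) (i : 'I_k.+1) : row i A = nrow A i.
Proof. by rewrite /nrow inord_val. Qed.

Lemma row_row' k (A : 'M[R]_(k.+1, n)) (i : 'I_k.+1) (j : 'I_k) :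
  row j (row' i A) = row (lift i j) A.
Proof. by apply/rowP => l; rewrite !mxE. Qed.

Lemma mx1E (B : 'M[R]_(1, n)) : B = nrow B 0.
Proof. by apply/matrixP => i j; rewrite mxE (ord1 i); congr (B _ _); apply: val_inj; rewrite /= inordK. Qed.

Lemma mx2E (B : 'M[R]_(2, n)) : B = mx2 (nrow B 0) (nrow B 1).
Proof.
apply/row_matrixP => i; case: (unliftP ord0 i) => [j|] ->.
  by rewrite (ord1 j) row_cons_mxS row_id row_nrow.
by rewrite row_cons_mx0 row_nrow.
Qed.

Lemma nrow_mx2 u v : (nrow (mx2 u v) 0 = u) * (nrow (mx2 u v) 1 = v).
Proof.
split.
  by rewrite -[0%N]/(nat_of_ord (ord0 : 'I_2)) -row_nrow row_cons_mx0.
by rewrite -[1%N]/(nat_of_ord (lift ord0 ord0 : 'I_2)) -row_nrow row_cons_mxS row_id.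
Qed.

Lemma nrow_row' k (A : 'M[R]_(k.+2, n)) (i : 'I_k.+2) (j : nat) : (j < k.+1)%N ->
  @nrow k (row' i A) j = nrow A (bump i j).
Proof.
move=> jk; rewrite {1}/nrow row_row' row_nrow; congr (nrow A _).
by rewrite /= inordK.
Qed.

Lemma ext_prod11 (a b : 'M[R]_(1, n) -> K) A :
  ext_prod a b A = a (nrow A 0) * b (nrow A 1) - a (nrow A 1) * b (nrow A 0).
Proof.
rewrite ext_prod1; last exact: perm_sign1.
rewrite !big_ord_recl big_ord0 addr0 expr0 mul1r expr1 mulN1r.
have E (i : 'I_2) : row' i A = nrow A (bump i 0).
  by rewrite [LHS]mx1E; exact: nrow_row'.
by rewrite !E !row_nrow.
Qed.

(** Each term of the expansion occurs twice, with the arguments of [a] in both orders; skew-symmetry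
    merges them and the factor 2 is cancelled. Nothing more is asked of [a], which will be
    complex-valued. *)
Lemma ext_prod21 (a : 'M[R]_(2, n) -> K) (b : 'M[R]_(1, n) -> K) A :
  (forall u v, a (mx2 u v) = - a (mx2 v u)) ->
  ext_prod a b A = a (mx2 (nrow A 0) (nrow A 1)) * b (nrow A 2)
    - a (mx2 (nrow A 0) (nrow A 2)) * b (nrow A 1) + a (mx2 (nrow A 1) (nrow A 2)) * b (nrow A 0).
Proof.
move=> asym.
have := @ext_prod2 R K n 1 a b A (@perm_sign1 _ _ _ _).
have E (i : 'I_3) (j : 'I_2) : row' j (row' i A) = nrow A (bump i (bump j 0)).
  by rewrite [LHS]mx1E (@nrow_row' 0)// (@nrow_row' 1)// /bump; case: (j <= 0)%N.
have E' (i : 'I_3) (j : 'I_2) : row j (row' i A) = nrow A (bump i j).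
  by rewrite row_row' row_nrow.
rewrite !big_ord_recl !big_ord0 !E !E' !row_nrow /= /bump /= !add1n !add0n.
rewrite -!/(mx2 _ _) (asym (nrow A 1) (nrow A 0)) (asym (nrow A 2) (nrow A 0)) (asym (nrow A 2) (nrow A 1)).
move=> H; apply: (@mulfI _ 2); first by rewrite pnatr_eq0.
rewrite H; ring.
Qed.

End ExplicitExtProd.

Section ExplicitExtProdReal.
Context {R : realType} {n : nat}.
Implicit Types (a b : 'M[R]_(2, n) -> R).

Lemma alternating_mx2 a : multilinear_rows a -> alternating_rows a ->
  forall u v, a (mx2 u v) = - a (mx2 v u).
Proof.
move=> ma aa u v.
rewrite -(@alternating_xrow _ _ _ a ord0 (lift ord0 ord0))//; congr a.
apply/row_matrixP => i; case: (unliftP (ord0 : 'I_2) i) => [j|] ->.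
  rewrite (ord1 j) row_cons_mxS row_id; apply/rowP => l.
  by rewrite [RHS]mxE [RHS]mxE tpermR; exact: esym (@cons_mx0 R 1 n v u l).
rewrite row_cons_mx0; apply/rowP => l.
by rewrite [RHS]mxE [RHS]mxE tpermL; exact: esym (@cons_mxS R 1 n v u ord0 l).
Qed.

Lemma ext_prod12 (a : 'M[R]_(1, n) -> R) b A : multilinear_rows b -> alternating_rows b ->
  ext_prod a b A = a (nrow A 0) * b (mx2 (nrow A 1) (nrow A 2))
    - a (nrow A 1) * b (mx2 (nrow A 0) (nrow A 2)) + a (nrow A 2) * b (mx2 (nrow A 0) (nrow A 1)).
Proof.
move=> mb ab; rewrite ext_prod1; last by move=> B s; exact: alternating_row_perm.
have E (i : 'I_3) : row' i A = mx2 (nrow A (bump i 0)) (nrow A (bump i 1)).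
  by rewrite [LHS]mx2E !(@nrow_row' _ _ 1).
rewrite !big_ord_recl big_ord0 !E !row_nrow /= /bump /= !add1n !add0n.
by ring.
Qed.

Lemma ext_prod22 a b A : multilinear_rows a -> alternating_rows a ->
    multilinear_rows b -> alternating_rows b ->
  ext_prod a b A =
    a (mx2 (nrow A 0) (nrow A 1)) * b (mx2 (nrow A 2) (nrow A 3)) -
    a (mx2 (nrow A 0) (nrow A 2)) * b (mx2 (nrow A 1) (nrow A 3)) +
    a (mx2 (nrow A 0) (nrow A 3)) * b (mx2 (nrow A 1) (nrow A 2)) +
    a (mx2 (nrow A 1) (nrow A 2)) * b (mx2 (nrow A 0) (nrow A 3)) -
    a (mx2 (nrow A 1) (nrow A 3)) * b (mx2 (nrow A 0) (nrow A 2)) +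
    a (mx2 (nrow A 2) (nrow A 3)) * b (mx2 (nrow A 0) (nrow A 1)).
Proof.
move=> ma aa mb ab; have asym := alternating_mx2 ma aa.
have hb B (s : 'S_2) : b (row_perm s B) = (-1) ^+ s * b B by exact: alternating_row_perm.
have := @ext_prod2 R R n 2 a b A hb.
have E (i : 'I_4) (j : 'I_3) : row' j (row' i A) =
    mx2 (nrow A (bump i (bump j 0))) (nrow A (bump i (bump j 1))).
  by rewrite [LHS]mx2E !(@nrow_row' _ _ 1)// !(@nrow_row' _ _ 2)// /bump; case: (j <= _)%N.
have E' (i : 'I_4) (j : 'I_3) : row j (row' i A) = nrow A (bump i j).
  by rewrite row_row' row_nrow.
rewrite !big_ord_recl !big_ord0 !E !E' !row_nrow /= /bump /= !add1n !add0n.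
rewrite -!/(mx2 _ _) (asym (nrow A 1) (nrow A 0)) (asym (nrow A 2) (nrow A 0)) (asym (nrow A 2) (nrow A 1))
  (asym (nrow A 3) (nrow A 0)) (asym (nrow A 3) (nrow A 1)) (asym (nrow A 3) (nrow A 2)).
move=> H; apply: (@mulfI _ 2); first by rewrite pnatr_eq0.
rewrite H; ring.
Qed.

(** Only permutations fixing the last index contribute. There are 4! of them, all with the same
    contribution, and this cancels the normalisation. *)
Lemma ext_prod41_last (a : 'M[R]_(4, n) -> R) (b : 'M[R]_(1, n) -> R) A :
  multilinear_rows a -> alternating_rows a ->
  (forall i : 'I_5, i != ord_max -> b (row i A) = 0) ->
  ext_prod a b A = a (row' ord_max A) * b (row ord_max A).
Proof.
move=> ma aa hb; rewrite /ext_prod (@sum_lift_perm R 4 ord_max).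
have bE (s : 'S_5) : dsubmx (row_perm s A : 'M[R]_(4 + 1, n)) = row (s ord_max) A.
  apply/rowP => j; rewrite !mxE; congr (A (s _) j).
  by apply: val_inj.
rewrite (bigD1 ord_max)//= [X in _ * (_ + X)]big1 ?addr0; last first.
  move=> i im; apply: big1 => t _.
  by rewrite bE lift_perm_id hb// mulr0.
under eq_bigr => t _.
  rewrite bE lift_perm_id odd_lift_perm.
  have -> : usubmx (row_perm (lift_perm ord_max ord_max t) A : 'M[R]_(4 + 1, n)) = row_perm t (row' ord_max A).
    apply/matrixP => i j; rewrite !mxE.
    have -> : lshift 1 i = lift ord_max i by apply: val_inj; rewrite /= /bump leqNgt ltn_ord.
    by rewrite lift_perm_lift.
  rewrite alternating_row_perm// mulrA addbb /= -expr2 sqrr_sign mul1r.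
  over.
have -> : (4`! * 1`! = 4`!)%N by [].
rewrite /= sumr_const card_Sn -[X in _ * X]mulr_natl mulKf//.
Qed.

End ExplicitExtProdReal.

(** * Coframes adapted to a unit vector *)

Section SU3Frame.
Context {R : realType}.

Definition mx3 n (u v w : 'rV[R]_n) : 'M[R]_(3, n) := @col_mx R 1 2 n u (mx2 v w).

Lemma nrow_mx3 n (u v w : 'rV[R]_n) :
  (nrow (mx3 u v w) 0 = u) * (nrow (mx3 u v w) 1 = v) * (nrow (mx3 u v w) 2 = w).
Proof.
have E i : nrow (mx3 u v w) (lift ord0 i : 'I_3) = nrow (mx2 v w) i.
  by rewrite -!row_nrow row_cons_mxS.
split; [split|].
- by rewrite -[0%N]/(nat_of_ord (ord0 : 'I_3)) -row_nrow row_cons_mx0.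
- by have := E ord0; rewrite nrow_mx2.
- by have := E (lift ord0 ord0); rewrite nrow_mx2.
Qed.

(* re12 and im12 are the real and imaginary parts of z1 /\ z2, where
   zj = xj + i yj. *)
Definition re12 n (x1 y1 x2 y2 : 'rV[R]_n -> R) (u v : 'rV[R]_n) :=
  x1 u * x2 v - y1 u * y2 v - (x1 v * x2 u - y1 v * y2 u).

Definition im12 n (x1 y1 x2 y2 : 'rV[R]_n -> R) (u v : 'rV[R]_n) :=
  x1 u * y2 v + y1 u * x2 v - (x1 v * y2 u + y1 v * x2 u).

(** Covectors are kept as columns, so that rotating a coframe is a linear combination of columns and
    restricting it along [T] is a product [T *m X]. *)
Definition functional n (X : 'cV[R]_n) (v : 'rV[R]_n) : R := (v *m X) 0 0.

Lemma functionalD n (X Y : 'cV[R]_n) v : functional (X + Y) v = functional X v + functional Y v.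
Proof. by rewrite /functional mulmxDr mxE. Qed.

Lemma functionalZ n a (X : 'cV[R]_n) v : functional (a *: X) v = a * functional X v.
Proof. by rewrite /functional -scalemxAr mxE. Qed.

Notation fc := functional.
Notation V := 'rV[R]_6.
Implicit Types (x y : V -> R).

(* F = x1 /\ y1 + x2 /\ y2 + x3 /\ y3, P + i M = z1 /\ z2 /\ z3, and g is the
   metric for which x1, ..., y3 are orthonormal. *)
Definition su3_frame (F : 'M[R]_(2, 6) -> R) (P M : 'M[R]_(3, 6) -> R) (g : V -> V -> R)
    x1 y1 x2 y2 x3 y3 : Prop :=
  [/\ forall u v, F (mx2 u v) = (x1 u * y1 v - x1 v * y1 u) + (x2 u * y2 v - x2 v * y2 u)
        + (x3 u * y3 v - x3 v * y3 u),
      forall u v w, P (mx3 u v w) =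
        re12 x1 y1 x2 y2 u v * x3 w - im12 x1 y1 x2 y2 u v * y3 w
        - (re12 x1 y1 x2 y2 u w * x3 v - im12 x1 y1 x2 y2 u w * y3 v)
        + (re12 x1 y1 x2 y2 v w * x3 u - im12 x1 y1 x2 y2 v w * y3 u),
      forall u v w, M (mx3 u v w) =
        re12 x1 y1 x2 y2 u v * y3 w + im12 x1 y1 x2 y2 u v * x3 w
        - (re12 x1 y1 x2 y2 u w * y3 v + im12 x1 y1 x2 y2 u w * x3 v)
        + (re12 x1 y1 x2 y2 v w * y3 u + im12 x1 y1 x2 y2 v w * x3 u) &
      forall u v, g u v = x1 u * x1 v + y1 u * y1 v + (x2 u * x2 v + y2 u * y2 v)
        + (x3 u * x3 v + y3 u * y3 v)].

(** A cyclic permutation of three factors is even. This carries the rotation of the first two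
    directions over to any other pair. *)
Lemma su3_frame_cycle F P M g x1 y1 x2 y2 x3 y3 :
  su3_frame F P M g x1 y1 x2 y2 x3 y3 -> su3_frame F P M g x2 y2 x3 y3 x1 y1.
Proof.
move=> [HF HP HM Hg]; split=> [u v|u v w|u v w|u v].
- by rewrite HF; ring.
- by rewrite HP /re12 /im12; ring.
- by rewrite HM /re12 /im12; ring.
- by rewrite Hg; ring.
Qed.

(* The new coframe is z1' = p z1 + q z2, z2' = - q^* z1 + p^* z2 for the
   element of SU(2) with p = a + i b and q = c + i d. *)
Lemma su3_frame_rotate F P M g x1 y1 x2 y2 x3 y3 (a b c d : R) :
  a ^+ 2 + b ^+ 2 + c ^+ 2 + d ^+ 2 = 1 ->
  su3_frame F P M g x1 y1 x2 y2 x3 y3 ->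
  su3_frame F P M g
    (fun u => a * x1 u - b * y1 u + c * x2 u - d * y2 u)
    (fun u => a * y1 u + b * x1 u + c * y2 u + d * x2 u)
    (fun u => - c * x1 u - d * y1 u + a * x2 u + b * y2 u)
    (fun u => - c * y1 u + d * x1 u + a * y2 u - b * x2 u) x3 y3.
Proof.
move=> abcd [HF HP HM Hg].
have E1 u v : re12 (fun u => a * x1 u - b * y1 u + c * x2 u - d * y2 u)
    (fun u => a * y1 u + b * x1 u + c * y2 u + d * x2 u)
    (fun u => - c * x1 u - d * y1 u + a * x2 u + b * y2 u)
    (fun u => - c * y1 u + d * x1 u + a * y2 u - b * x2 u) u v = re12 x1 y1 x2 y2 u v.
  by rewrite -[RHS]mul1r -abcd /re12; ring.
have E2 u v : im12 (fun u => a * x1 u - b * y1 u + c * x2 u - d * y2 u)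
    (fun u => a * y1 u + b * x1 u + c * y2 u + d * x2 u)
    (fun u => - c * x1 u - d * y1 u + a * x2 u + b * y2 u)
    (fun u => - c * y1 u + d * x1 u + a * y2 u - b * x2 u) u v = im12 x1 y1 x2 y2 u v.
  by rewrite -[RHS]mul1r -abcd /im12; ring.
split=> [u v|u v w|u v w|u v]; rewrite ?E1 ?E2//.
- rewrite HF; congr (_ + _); rewrite -[LHS]mul1r -abcd; ring.
- rewrite Hg; congr (_ + _); rewrite -[LHS]mul1r -abcd; ring.
Qed.

(** With m the square root of |z1(u)|^2 + |z2(u)|^2, the rotation with coefficients z2(u)/m and -
    z1(u)/m sends z1(u) to 0 and z2(u) to m. If m = 0, the identity will do. *)
Lemma su3_frame_align F P M g X1 Y1 X2 Y2 X3 Y3 (u : V) :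
  su3_frame F P M g (fc X1) (fc Y1) (fc X2) (fc Y2) (fc X3) (fc Y3) ->
  exists X1' Y1' X2' Y2',
    su3_frame F P M g (fc X1') (fc Y1') (fc X2') (fc Y2') (fc X3) (fc Y3) /\
    [/\ fc X1' u = 0, fc Y1' u = 0, fc Y2' u = 0 & 0 <= fc X2' u].
Proof.
move=> H.
set p := fc X1 u; set q := fc Y1 u; set r := fc X2 u; set s := fc Y2 u.
pose N := p ^+ 2 + q ^+ 2 + r ^+ 2 + s ^+ 2.
have N0 : 0 <= N by rewrite !addr_ge0 ?sqr_ge0.
have [a [b [c [d [abcd [e1 e2 e3 e4]]]]]] : exists a b c d, a ^+ 2 + b ^+ 2 + c ^+ 2 + d ^+ 2 = 1 /\
   [/\ a * p - b * q + c * r - d * s = 0, a * q + b * p + c * s + d * r = 0,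
       - c * q + d * p + a * s - b * r = 0 & 0 <= - c * p - d * q + a * r + b * s].
  have [N1|N1] := eqVneq N 0.
    have [p0 q0 r0 s0] : [/\ p = 0, q = 0, r = 0 & s = 0].
      move/eqP: N1; rewrite /N !paddr_eq0 ?addr_ge0 ?sqr_ge0// !sqrf_eq0.
      by case/andP => /andP[/andP[/eqP -> /eqP ->] /eqP ->] /eqP ->.
    exists 1, 0, 0, 0; rewrite p0 q0 r0 s0; split; first by ring.
    by rewrite !mulr0 !subr0 !addr0; split.
  pose m := Num.sqrt N.
  have m2 : m ^+ 2 = N by rewrite sqr_sqrtr.
  have m0 : m != 0 by rewrite sqrtr_eq0 -ltNge lt_neqAle eq_sym N1.
  exists (r / m), (s / m), (- (p / m)), (- (q / m)); split.
    by rewrite !sqrrN !expr_div_n m2 -!mulrDl [X in X / _](_ : _ = N) ?divff// /N; ring.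
  split; try by field.
  rewrite (_ : _ + _ = N / m); first by rewrite divr_ge0// sqrtr_ge0.
  by rewrite /N; field.
exists (a *: X1 + (- b) *: Y1 + c *: X2 + (- d) *: Y2),
       (a *: Y1 + b *: X1 + c *: Y2 + d *: X2),
       ((- c) *: X1 + (- d) *: Y1 + a *: X2 + b *: Y2),
       ((- c) *: Y1 + d *: X1 + a *: Y2 + (- b) *: X2).
have := su3_frame_rotate abcd H.
set h1 := (X in su3_frame _ _ _ _ X); set h2 := (X in su3_frame _ _ _ _ _ X).
set h3 := (X in su3_frame _ _ _ _ _ _ X); set h4 := (X in su3_frame _ _ _ _ _ _ _ X).
have -> : h1 = fc (a *: X1 + (- b) *: Y1 + c *: X2 + (- d) *: Y2).
  by apply/funext => v; rewrite /h1 !functionalD !functionalZ; ring.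
have -> : h2 = fc (a *: Y1 + b *: X1 + c *: Y2 + d *: X2).
  by apply/funext => v; rewrite /h2 !functionalD !functionalZ; ring.
have -> : h3 = fc ((- c) *: X1 + (- d) *: Y1 + a *: X2 + b *: Y2).
  by apply/funext => v; rewrite /h3 !functionalD !functionalZ; ring.
have -> : h4 = fc ((- c) *: Y1 + d *: X1 + a *: Y2 + (- b) *: X2).
  by apply/funext => v; rewrite /h4 !functionalD !functionalZ; ring.
move=> H'; split=> //; rewrite !functionalD !functionalZ -/p -/q -/r -/s !mulNr.
by move: e1 e2 e3 e4; rewrite !mulNr.
Qed.

Lemma su3_frame_unit F P M g X1 Y1 X2 Y2 X3 Y3 (u : V) :
  su3_frame F P M g (fc X1) (fc Y1) (fc X2) (fc Y2) (fc X3) (fc Y3) -> g u u = 1 ->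
  exists X1' Y1' X2' Y2' X3' Y3',
    su3_frame F P M g (fc X1') (fc Y1') (fc X2') (fc Y2') (fc X3') (fc Y3') /\
    [/\ fc X1' u = 0, fc Y1' u = 0, fc X2' u = 0 & fc Y2' u = 0] /\
    fc X3' u = 1 /\ fc Y3' u = 0.
Proof.
move=> H gu.
have [A1 [B1 [A2 [B2 [H1 [a1 b1 _ _]]]]]] := su3_frame_align u H.
(* The cycled order is z2, z3, z1: this rotation leaves z1 alone, so z1(u) = 0 persists. Two more
   cycles restore the order. *)
have [A2' [B2' [A3 [B3 [H2 [a2 b2 b3 a3]]]]]] := su3_frame_align u (su3_frame_cycle H1).
have H3 := su3_frame_cycle (su3_frame_cycle H2).
exists A1, B1, A2', B2', A3, B3; split=> //; split=> //; split=> //.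
case: H3 => _ _ _ Hg; move: gu; rewrite Hg a1 b1 a2 b2 b3 !mulr0 !add0r !addr0 -expr2.
(* Only x3(u)^2 = 1 is left of the unit norm, and the sign secured by the alignment excludes -1. *)
by move/eqP; rewrite sqrf_eq1 => /orP[/eqP//|/eqP E]; move: a3; rewrite E oppr_ge0 ler10.
Qed.


Lemma mulcE (a b c d : R) : ((a +i* b) * (c +i* d) = (a * c - b * d) +i* (a * d + b * c))%C.
Proof. by []. Qed.

Lemma addcE (a b c d : R) : ((a +i* b) + (c +i* d) = (a + c) +i* (b + d))%C.
Proof. by []. Qed.

Lemma oppcE (a b : R) : (- (a +i* b) = (- a) +i* (- b))%C.
Proof. by []. Qed.

Lemma multilinear_functional n (a : 'rV[R]_n -> R) :
  @multilinear_rows R 1 n a -> a = fc (\col_j a (delta_mx 0 j)).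
Proof.
move=> ma; apply/funext => v.
have E w : set_row ord0 w v = w.
  by apply/matrixP => i j; rewrite set_rowE !ord1 eqxx.
have := multilinear_set_row_sum ord0 v v ma; rewrite E => ->.
by rewrite /fc mxE; apply: eq_bigr => j _; rewrite E mxE.
Qed.

(** Six independent covectors in dimension 6 form an invertible matrix, hence separate vectors. *)
Lemma coframe_nondegenerate (e : 'I_6 -> V -> R) :
  (forall i, @multilinear_rows R 1 6 (e i)) ->
  (forall r : 'I_6 -> R, (forall v, \sum_i r i * e i v = 0) -> forall i, r i = 0) ->
  forall v, (forall i, e i v = 0) -> v = 0.
Proof.
move=> me ie v ev.
pose E : 'M[R]_6 := \matrix_(j, i) e i (delta_mx 0 j).
have eE i w : e i w = (w *m E) 0 i.
  rewrite (multilinear_functional (me i)) /fc !mxE.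
  by apply: eq_bigr => j _; rewrite !mxE.
have Eu : E \in unitmx.
  rewrite -unitmx_tr -row_free_unit; apply: inj_row_free => r rE.
  apply/rowP => i; rewrite [RHS]mxE; apply: (ie (fun i => r 0 i)) => w.
  have : (r *m E^T *m w^T) 0 0 = 0 by rewrite rE mul0mx mxE.
  rewrite -mulmxA -trmx_mul mxE => E0; rewrite -[RHS]E0.
  by apply: eq_bigr => j _; rewrite eE [in RHS]mxE.
by rewrite -[v](mulmxK Eu) (_ : v *m E = 0) ?mul0mx//; apply/rowP => i; rewrite -eE ev mxE.
Qed.

Lemma adapted_coframe_su3_frame F P M (e : 'I_6 -> V -> R) :
  adapted_coframe F P M e ->
  su3_frame F P M (fun u v => \sum_(i < 6) e i u * e i v) (e 0) (e 1) (e 2) (e 3) (e 4) (e 5).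
Proof.
move=> [me ie HF HC].
have Z i j A : ext_prod (e i) (e j) A = e i (nrow A 0) * e j (nrow A 1) - e i (nrow A 1) * e j (nrow A 0).
  exact: ext_prod11.
have HC' u v w : (P (mx3 u v w) +i* M (mx3 u v w))%C =
   (let z i j v := (e i v +i* e j v)%C in
   (z 0 1 u * z 2 3 v - z 0 1 v * z 2 3 u) * z 4 5 w
   - (z 0 1 u * z 2 3 w - z 0 1 w * z 2 3 u) * z 4 5 v
   + (z 0 1 v * z 2 3 w - z 0 1 w * z 2 3 v) * z 4 5 u)%R.
  rewrite HC /= ext_prod21; last by move=> u' v'; rewrite !ext_prod11 !nrow_mx2 opprB.
  by rewrite !ext_prod11 !nrow_mx2 !nrow_mx3.
split=> [u v|u v w|u v w|u v].
- by rewrite HF !Z !nrow_mx2.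
- have := HC' u v w; rewrite /= !(mulcE, addcE, oppcE) => -[-> _].
  by rewrite /re12 /im12; ring.
- have := HC' u v w; rewrite /= !(mulcE, addcE, oppcE) => -[_ ->].
  by rewrite /re12 /im12; ring.
- rewrite !big_ord_recl big_ord0 addr0.
  have E (i : 'I_6) (j : 'I_6) : nat_of_ord i = j -> e i = e j by move=> ij; congr e; exact: val_inj.
  rewrite (E (lift ord0 ord0) 1)// (E (lift ord0 (lift ord0 ord0)) 2)//.
  rewrite (E (lift ord0 (lift ord0 (lift ord0 ord0))) 3)//.
  rewrite (E (lift ord0 (lift ord0 (lift ord0 (lift ord0 ord0)))) 4)//.
  rewrite (E (lift ord0 (lift ord0 (lift ord0 (lift ord0 (lift ord0 ord0))))) 5)//.
  rewrite (E ord0 0)//.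
  by rewrite !addrA.
Qed.

(* h is the restriction to the hypersurface of x1, y1, x2, y2, y3 for a coframe
   in which u is dual to x3; there x3 vanishes because u is normal. *)
Lemma hypersurface_coframe F P M (e : 'I_6 -> V -> R) (u : V) (T : 'M[R]_(5, 6)) :
  adapted_coframe F P M e -> \sum_(i < 6) e i u * e i u = 1 ->
  (forall v, \sum_(i < 6) e i u * e i (v *m T) = 0) -> row_free T ->
  exists h : 'I_5 -> 'cV[R]_5,
  [/\ forall v, (forall i, fc (h i) v = 0) -> v = 0,
      forall v, F (mx2 u (v *m T)) = fc (h 4) v,
      forall v w, F (mx2 (v *m T) (w *m T)) =
        fc (h 0) v * fc (h 1) w - fc (h 0) w * fc (h 1) v +
        (fc (h 2) v * fc (h 3) w - fc (h 2) w * fc (h 3) v) &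
      (forall v w, P (mx3 u (v *m T) (w *m T)) =
        re12 (fc (h 0)) (fc (h 1)) (fc (h 2)) (fc (h 3)) v w) /\
      (forall v w, M (mx3 u (v *m T) (w *m T)) =
        im12 (fc (h 0)) (fc (h 1)) (fc (h 2)) (fc (h 3)) v w) /\
      (forall v w z, P (mx3 (v *m T) (w *m T) (z *m T)) =
        - (im12 (fc (h 0)) (fc (h 1)) (fc (h 2)) (fc (h 3)) v w * fc (h 4) z
         - im12 (fc (h 0)) (fc (h 1)) (fc (h 2)) (fc (h 3)) v z * fc (h 4) w
         + im12 (fc (h 0)) (fc (h 1)) (fc (h 2)) (fc (h 3)) w z * fc (h 4) v))].
Proof.
move=> ade uu uT rT.
have [me ie _ _] := ade.
have nd := coframe_nondegenerate me ie.
have H0 := adapted_coframe_su3_frame ade.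
have fcE i : e i = fc (\col_j e i (delta_mx 0 j)) by apply: multilinear_functional; exact: me.
rewrite (fcE 0) (fcE 1) (fcE 2) (fcE 3) (fcE 4) (fcE 5) in H0.
have [X1 [Y1 [X2 [Y2 [X3 [Y3 [[HF HP HM Hg] [[x1 y1 x2 y2] [x3 y3]]]]]]]]] := su3_frame_unit H0 uu.
(* In the aligned coframe the covector g(u, .) is x3. *)
have x3T v : fc X3 (v *m T) = 0.
  by have := uT v; rewrite Hg x1 y1 x2 y2 x3 y3 !mul0r !add0r addr0 mul1r.
exists (fun i => T *m tnth [tuple X1; Y1; X2; Y2; Y3] i).
have hT X v : fc (T *m X) v = fc X (v *m T) by rewrite /fc mulmxA.
split=> [v hv|v|v w|].
(* Nondegeneracy is known for the original coframe [e]; the metric, common to both coframes, passes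
   it on to the aligned one through a vanishing sum of squares. *)
- have eT : v *m T = 0.
    apply: nd.
    have : \sum_(i < 6) e i (v *m T) * e i (v *m T) = 0.
      rewrite Hg x3T.
      have := hv 0; have := hv 1; have := hv 2; have := hv 3; have := hv 4.
      rewrite !hT !(tnth_nth 0) /= => -> -> -> -> ->.
      by rewrite !mulr0 !addr0.
    move=> /eqP; rewrite psumr_eq0; last by move=> i _; rewrite -expr2 sqr_ge0.
    move=> /allP H i; have := H i (mem_index_enum i); rewrite /= mulf_eq0 orbb.
    by move/eqP.
  by apply: (row_free_inj rT); rewrite /= eT mul0mx.
- rewrite HF x1 y1 x2 y2 x3 y3 !hT !(tnth_nth 0) /=; ring.
- by rewrite HF !x3T !hT !(tnth_nth 0) /=; ring.
- split; last split => [v w|v w z].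
  + by move=> v w; rewrite HP /re12 /im12 x1 y1 x2 y2 x3 y3 !x3T !hT !(tnth_nth 0) /=; ring.
  + by rewrite HM /re12 /im12 x1 y1 x2 y2 x3 y3 !x3T !hT !(tnth_nth 0) /=; ring.
  + by rewrite HP /re12 /im12 !x3T !hT !(tnth_nth 0) /=; ring.
Qed.

End SU3Frame.

(** * Pointwise SU(2)-structures *)

Section SU2Frame.
Context {R : realType}.
Notation V := 'rV[R]_5.
Notation fc := functional.
Variables (h : 'I_5 -> 'cV[R]_5).
Hypothesis nd : forall v, (forall i, fc (h i) v = 0) -> v = 0.

Lemma dual_basis : exists b : 'M[R]_5, forall i j, fc (h i) (row j b) = (i == j)%:R.
Proof.
pose G : 'M[R]_5 := \matrix_(k, i) h i k 0.
have GE i v : fc (h i) v = (v *m G) 0 i.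
  by rewrite /fc !mxE; apply: eq_bigr => k _; rewrite mxE.
have Gu : G \in unitmx.
  rewrite -row_free_unit; apply: inj_row_free => r rE; apply: nd => i.
  by rewrite GE rE mxE.
by exists (invmx G) => i j; rewrite GE -row_mul mulVmx// !mxE eq_sym.
Qed.

Variables (w1 w2 w3 : 'M[R]_(2, 5) -> R) (eta : 'M[R]_(1, 5) -> R).
Hypothesis w1E : forall v w, w1 (mx2 v w) = - im12 (fc (h 0)) (fc (h 1)) (fc (h 2)) (fc (h 3)) v w.
Hypothesis w2E : forall v w, w2 (mx2 v w) =
  fc (h 0) v * fc (h 1) w - fc (h 0) w * fc (h 1) v +
        (fc (h 2) v * fc (h 3) w - fc (h 2) w * fc (h 3) v).
Hypothesis w3E : forall v w, w3 (mx2 v w) = - re12 (fc (h 0)) (fc (h 1)) (fc (h 2)) (fc (h 3)) v w.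
Hypothesis etaE : forall v, eta v = - fc (h 4) v.

(** Testing on dual basis vectors shows that the first four coordinates of [Y] are those of [X]
    turned by a right angle in the planes (0, 1) and (2, 3); so [w2 (mx2 X Y)] is the sum of the
    squares of those of [X]. *)
Lemma su2_positive (X Y : V) : (forall Z : V, w3 (mx2 X Z) = w1 (mx2 Y Z)) -> 0 <= w2 (mx2 X Y).
Proof.
move=> H; have [b bE] := dual_basis.
have := H (row 0 b); have := H (row 1 b); have := H (row 2 b); have := H (row 3 b).
rewrite !w1E !w3E /re12 /im12 !bE /= !(mulr0, mulr1, addr0, subr0, add0r, sub0r, oppr0, opprK).
move=> E3 E2 E1 E0.
rewrite w2E.
have -> : fc (h 1) Y = fc (h 0) X by lra.
have -> : fc (h 0) Y = - fc (h 1) X by lra.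
have -> : fc (h 3) Y = fc (h 2) X by lra.
have -> : fc (h 2) Y = - fc (h 3) X by lra.
by rewrite !mulNr !opprK -!expr2 !addr_ge0 ?sqr_ge0.
Qed.

Hypotheses (m1 : multilinear_rows w1) (m2 : multilinear_rows w2) (m3 : multilinear_rows w3).
Hypotheses (a1 : alternating_rows w1) (a2 : alternating_rows w2) (a3 : alternating_rows w3).

(** Up to sign, the three forms are the standard self-dual 2-forms in the first four covectors. *)
Lemma su2_wedge (i j : 'I_3) A :
  ext_prod (tnth [tuple w1; w2; w3] i) (tnth [tuple w1; w2; w3] j) A =
  (i == j)%:R * ext_prod w2 w2 A.
Proof.
rewrite !(tnth_nth w1); case: i => [[|[|[|//]]] ?]; case: j => [[|[|[|//]]] ?] /=;
  rewrite !ext_prod22// ?w1E ?w2E ?w3E /re12 /im12 /=; ring.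
Qed.

Lemma su2_eta_neq0 : exists A, eta A != 0.
Proof.
have [b bE] := dual_basis.
by exists (row 4 b); rewrite etaE bE eqxx oppr_eq0 oner_eq0.
Qed.

Lemma su2_volume b : (forall i j, fc (h i) (row j b) = (i == j)%:R) ->
  ext_prod w2 w2 (row' ord_max b) != 0.
Proof.
move=> bE; rewrite ext_prod22// !w2E.
have E (i : 'I_5) (k : nat) : (k < 4)%N -> fc (h i) (@nrow R 5 3 (row' ord_max b) k) = (i == k :> nat)%:R.
  move=> k4; have bk : bump 4 k = k by rewrite /bump leqNgt k4.
  by rewrite nrow_row'// /nrow bE -val_eqE /= bk inordK// (ltn_trans k4).
rewrite !E//= !(mulr0, mulr1, addr0, subr0, add0r, sub0r, oppr0, mul0r).
Qed.

Lemma su2_volume_neq0 : exists A, ext_prod w2 w2 A != 0.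
Proof. by have [b bE] := dual_basis; exists (row' ord_max b); exact: su2_volume. Qed.

Lemma su2_top_neq0 : exists A, ext_prod (ext_prod w2 w2) eta A != 0.
Proof.
have [b bE] := dual_basis; exists b.
rewrite (@ext_prod41_last R 5 (ext_prod w2 w2) eta b).
- rewrite mulf_neq0//; first exact: su2_volume.
  by rewrite etaE bE oppr_eq0 oner_eq0.
- exact: (@multilinear_ext_prod _ _ 2 2).
- exact: (@alternating_ext_prod _ _ 2 2).
- move=> i im; rewrite etaE bE.
  rewrite (_ : (4 : 'I_5) = ord_max); last exact: val_inj.
  by rewrite eq_sym (negPf im) oppr0.
Qed.

End SU2Frame.

(** * Hypo-contact structure on the hypersurface *)

Section ExtDAlgebra.
Context {R : realType} {n : nat} (M : manifold R n).
Implicit Types (p : M).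

Lemma form_in_differentiable D k (a : kform M k) c p A : open D -> smooth_form_on D a ->
  atlas c -> cdom c p -> D p -> differentiable (fun x => form_in a c x A) (cmap c p).
Proof.
move=> oD [_ sa] ac cp Dp; apply: (smooth_on_differentiable (sa c A ac)).
by exists p.
Qed.

Lemma ext_dN k (a : kform M k) p A : smooth_form a ->
  ext_d (fun p A => - a p A) p A = - ext_d a p A.
Proof.
move=> sa; rewrite /ext_d -sumrN; apply: eq_bigr => i _.
have da : differentiable (fun x => form_in a (chart_at p) x (row' i A)) (cmap (chart_at p) p).
  by apply: (form_in_differentiable _ openT sa) => //; [exact: chart_at_atlas|exact: chart_at_dom].
rewrite -mulrN; congr (_ * _).
by rewrite -deriveN//; exact: diff_derivable.
Qed.

Lemma ext_d1 (a : kform M 1) p u v :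
  ext_d a p (mx2 u v) =
  'D_u (fun x => form_in a (chart_at p) x v) (cmap (chart_at p) p) -
  'D_v (fun x => form_in a (chart_at p) x u) (cmap (chart_at p) p).
Proof.
rewrite /ext_d !big_ord_recl big_ord0 addr0 expr0 mul1r expr1 mulN1r.
have E (i : 'I_2) : row' i (mx2 u v) = nrow (mx2 u v) (bump i 0).
  by rewrite [LHS]mx1E; exact: (@nrow_row' _ _ 0).
by rewrite !E !row_nrow !nrow_mx2.
Qed.

Lemma ext_d2 (a : kform M 2) p u v w :
  ext_d a p (mx3 u v w) =
  'D_u (fun x => form_in a (chart_at p) x (mx2 v w)) (cmap (chart_at p) p) -
  'D_v (fun x => form_in a (chart_at p) x (mx2 u w)) (cmap (chart_at p) p) +
  'D_w (fun x => form_in a (chart_at p) x (mx2 u v)) (cmap (chart_at p) p).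
Proof.
rewrite /ext_d !big_ord_recl big_ord0 addr0 expr0 mul1r expr1 mulN1r.
have E (i : 'I_3) : row' i (mx3 u v w) =
    mx2 (nrow (mx3 u v w) (bump i 0)) (nrow (mx3 u v w) (bump i 1)).
  by rewrite [LHS]mx2E !(@nrow_row' _ _ 1).
rewrite !E !row_nrow /= /bump /= !add1n !add0n !nrow_mx3.
by rewrite addrA -signr_odd/= expr0 mul1r.
Qed.

(** The Leibniz rule d(a /\ b) = da /\ b - a /\ db, written out on four vectors. In a chart both
    sides are polynomials in values and first derivatives of the coefficients. *)
Lemma ext_d_wedge12 (a : kform M 1) (b : kform M 2) p A : smooth_form a -> smooth_form b ->
  let v := nrow A in
  ext_d (wedge a b) p A =
    ext_d a p (mx2 (v 0%N) (v 1%N)) * b p (mx2 (v 2%N) (v 3%N))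
    - ext_d a p (mx2 (v 0%N) (v 2%N)) * b p (mx2 (v 1%N) (v 3%N))
    + ext_d a p (mx2 (v 0%N) (v 3%N)) * b p (mx2 (v 1%N) (v 2%N))
    + ext_d a p (mx2 (v 1%N) (v 2%N)) * b p (mx2 (v 0%N) (v 3%N))
    - ext_d a p (mx2 (v 1%N) (v 3%N)) * b p (mx2 (v 0%N) (v 2%N))
    + ext_d a p (mx2 (v 2%N) (v 3%N)) * b p (mx2 (v 0%N) (v 1%N))
    - (a p (v 0%N) * ext_d b p (mx3 (v 1%N) (v 2%N) (v 3%N))
       - a p (v 1%N) * ext_d b p (mx3 (v 0%N) (v 2%N) (v 3%N))
       + a p (v 2%N) * ext_d b p (mx3 (v 0%N) (v 1%N) (v 3%N))
       - a p (v 3%N) * ext_d b p (mx3 (v 0%N) (v 1%N) (v 2%N))).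
Proof.
move=> sa sb v.
set c := chart_at p; set x := cmap c p.
have ac : atlas c by exact: chart_at_atlas.
have cp : cdom c p by exact: chart_at_dom.
have da B u : derivable (fun y => form_in a c y B) x u.
  by apply: diff_derivable; exact: (form_in_differentiable _ openT sa).
have db B u : derivable (fun y => form_in b c y B) x u.
  by apply: diff_derivable; exact: (form_in_differentiable _ openT sb).
pose H k y := form_in a c y (v k).
pose W k l y := form_in b c y (mx2 (v k) (v l)).
have Hx k : H k x = a p (v k) by exact: form_in_chart_at.
have Wx k l : W k l x = b p (mx2 (v k) (v l)) by exact: form_in_chart_at.
have E (i : 'I_4) : 'D_(row i A) (fun y => form_in (wedge a b) c y (row' i A)) x =
    H (bump i 0) x * 'D_(v i) (W (bump i 1) (bump i 2)) x +
    W (bump i 1) (bump i 2) x * 'D_(v i) (H (bump i 0)) x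
    - (H (bump i 1) x * 'D_(v i) (W (bump i 0) (bump i 2)) x +
       W (bump i 0) (bump i 2) x * 'D_(v i) (H (bump i 1)) x)
    + (H (bump i 2) x * 'D_(v i) (W (bump i 0) (bump i 1)) x +
       W (bump i 0) (bump i 1) x * 'D_(v i) (H (bump i 2)) x).
  rewrite row_nrow -/v.
  have near_wedge : \forall y \near x, (H (bump i 0) * W (bump i 1) (bump i 2)
     - H (bump i 1) * W (bump i 0) (bump i 2) + H (bump i 2) * W (bump i 0) (bump i 1)) y =
     form_in (wedge a b) c y (row' i A).
    apply: filterS (near_chart openT cp I) => _ [q [cq _] ->].
    have [mb ab] := sb.1 q I.
    rewrite form_in_wedge ext_prod12; first by rewrite !(@nrow_row' _ _ 2).
      exact: form_in_multilinear.
    exact: form_in_alternating.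
  rewrite -(near_eq_derive _ near_wedge).
  have dH k : derivable (H k) x (v i) by exact: da.
  have dW k l : derivable (W k l) x (v i) by exact: db.
  have dM k l m : derivable (H k * W l m) x (v i) by apply: derivableM.
  rewrite deriveD//; last exact: derivableB.
  by rewrite deriveB// !deriveM.
rewrite {1}/ext_d -/c -/x !big_ord_recl big_ord0 addr0 !E /= /bump /= !add1n !add0n.
rewrite !ext_d1 !ext_d2 -/c -/x -!/(H _) -!/(W _ _) -!Hx -!Wx.
pose h k := H k x; pose w k l := W k l x.
pose dh i k := 'D_(v i) (H k) x; pose dw i k l := 'D_(v i) (W k l) x.
rewrite -!/(h _) -!/(w _ _) -!/(dh _ _) -!/(dw _ _ _).
(* Values and derivatives become opaque atoms for [ring]. *)
clearbody h w dh dw.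
by ring.
Qed.

End ExtDAlgebra.

Lemma mx2_mulmx (R : realType) m n (u v : 'rV[R]_m) (T : 'M[R]_(m, n)) :
  mx2 u v *m T = mx2 (u *m T) (v *m T).
Proof. exact: (mul_col_mx u v T). Qed.

Lemma mx3E (R : realType) n (A : 'M[R]_(3, n)) : A = mx3 (nrow A 0) (nrow A 1) (nrow A 2).
Proof.
apply/row_matrixP => i; case: (unliftP (ord0 : 'I_3) i) => [j|] ->.
  rewrite row_cons_mxS; case: (unliftP (ord0 : 'I_2) j) => [k|] ->.
    by rewrite (ord1 k) row_cons_mxS row_id row_nrow.
  by rewrite row_cons_mx0 row_nrow.
by rewrite row_cons_mx0 row_nrow.
Qed.

Lemma mx3_mulmx (R : realType) m n (u v w : 'rV[R]_m) (T : 'M[R]_(m, n)) :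
  mx3 u v w *m T = mx3 (u *m T) (v *m T) (w *m T).
Proof. by rewrite /mx3 -mx2_mulmx; exact: (mul_col_mx u (mx2 v w) T). Qed.

Theorem theorem2p5 (R : realType) (M : manifold R 6)
    (F : kform M 2) (Psip Psim : kform M 3)
    (N : manifold R 5) (f : N -> M) (mu : kform N 5)
    (D : set M) (U : vfield M) :
  half_flat F Psip Psim ->
  oriented_hypersurface f mu ->
  unit_normal_on F Psip Psim f mu D U ->
  (forall q A, ext_d F q A = 2 * Psip q A) ->
  (forall q A, D q -> lie_derivative U F q A = 0) ->
  let eta : kform N 1 := fun p A => - pullback f (interior_prod U F) p A in
  let omega1 : kform N 2 := fun p A => - pullback f (interior_prod U Psim) p A in
  let omega2 : kform N 2 := pullback f F in
  let omega3 : kform N 2 := fun p A => - pullback f (interior_prod U Psip) p A in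
  hypo_contact eta omega1 omega2 omega3.
Proof.
move=> [[sF sP sM coframe] _ dP] [[sf rf] _ _] [[oD Df sU] [uU nU _]] dF LU eta omega1 omega2 omega3.
have onD k (a : kform M k) : smooth_form a -> smooth_form_on D a by exact: smooth_form_onS.
have sUF := smooth_interior oD (onD _ _ sF) sU.
have sUP := smooth_interior oD (onD _ _ sP) sU.
have sUM := smooth_interior oD (onD _ _ sM) sU.
have sfUF := smooth_pullback sf oD Df sUF.
have seta : smooth_form eta by exact: smooth_formN openT sfUF.
have s1 : smooth_form omega1 by exact: smooth_formN openT (smooth_pullback sf oD Df sUM).
have s2 : smooth_form (pullback f F) := smooth_pullback sf oD Df (onD _ _ sF).
rewrite -/omega2 in s2.
have s3 : smooth_form omega3 by exact: smooth_formN openT (smooth_pullback sf oD Df sUP).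
have frame p : exists h : 'I_5 -> 'cV[R]_5,
  [/\ forall v, (forall i, functional (h i) v = 0) -> v = 0,
      forall v w, omega1 p (mx2 v w) =
        - im12 (functional (h 0)) (functional (h 1)) (functional (h 2)) (functional (h 3)) v w,
      forall v w, omega2 p (mx2 v w) =
        functional (h 0) v * functional (h 1) w - functional (h 0) w * functional (h 1) v +
        (functional (h 2) v * functional (h 3) w - functional (h 2) w * functional (h 3) v),
      forall v w, omega3 p (mx2 v w) =
        - re12 (functional (h 0)) (functional (h 1)) (functional (h 2)) (functional (h 3)) v w &
      (forall v, eta p v = - functional (h 4) v) /\
      (forall A, pullback f Psip p A = - wedge eta omega1 p A)].
  set q := f p.
  (* The coframe used is the one that [SU3_metric] selects, so that the conditions on U apply to it
     as they stand. *)
  have ade : adapted_coframe (F q) (Psip q) (Psim q)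
      (get [set e | adapted_coframe (F q) (Psip q) (Psim q) e]).
    apply: (@getPex _ [set e | adapted_coframe (F q) (Psip q) (Psim q) e]).
    have [E [e [_ Eq _ H]]] := coframe q.
    by exists (fun i => e i q); exact: H.
  have [h [nd hF2 hF hP]] := hypersurface_coframe ade (uU q (Df p)) (nU p) (rf p).
  have [hP2 [hM2 hP3]] := hP.
  have e1 v w : omega1 p (mx2 v w) =
      - im12 (functional (h 0)) (functional (h 1)) (functional (h 2)) (functional (h 3)) v w.
    by rewrite -hM2 /omega1 /pullback mx2_mulmx.
  have e4 v : eta p v = - functional (h 4) v by rewrite -hF2.
  exists h; split=> //.
  - by move=> v w; rewrite -hF /omega2 /pullback mx2_mulmx.
  - by move=> v w; rewrite -hP2 /omega3 /pullback mx2_mulmx.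
  - split=> // A.
    have [m1 al1] := s1.1 p I.
    rewrite /wedge (ext_prod12 _ _ m1 al1).
    rewrite !e1 !e4 {1}(mx3E A) /pullback mx3_mulmx hP3.
    by ring.
have deta p A : ext_d eta p A = - 2 * omega3 p A.
  rewrite /eta ext_dN// (ext_d_pullback sf _ oD (Df p) sUF).
  have := cartan (A *m tangent_map f p) oD (Df p) (onD _ _ sF) sU.
  rewrite LU// dF => /eqP; rewrite eq_sym addr_eq0 => /eqP E.
  rewrite /pullback E opprK /omega3 /pullback /interior_prod.
  by rewrite mulrNN.
have domega2 p A : ext_d omega2 p A = - 2 * wedge eta omega1 p A.
  rewrite (ext_d_pullback sf _ oD (Df p) (onD _ _ sF)) /pullback dF.
  have [h [_ _ _ _ [_ H]]] := frame p.
  by rewrite -[Psip _ _]/(pullback f Psip p A) H mulrN mulNr.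
split=> //.
- split=> //.
  + move=> p; have [h [nd e1 e2 e3 [e4 _]]] := frame p.
    exact: (su2_eta_neq0 nd e4).
  + by move=> i; rewrite (tnth_nth omega1); case: i => [[|[|[|//]]] ?].
  + exists (wedge omega2 omega2); split.
    * exact: (smooth_wedge openT s2 s2).
    * move=> p; have [h [nd e1 e2 e3 [e4 _]]] := frame p.
      by apply: (su2_volume_neq0 nd e2); have [] := s2.1 p I.
    * move=> p; have [h [nd e1 e2 e3 [e4 _]]] := frame p.
      by apply: (su2_top_neq0 nd e2 e4); have [] := s2.1 p I.
    * move=> i j p A; have [h [nd e1 e2 e3 [e4 _]]] := frame p.
      have tE k : tnth [tuple omega1; omega2; omega3] k p =
          tnth [tuple omega1 p; omega2 p; omega3 p] k.
        by rewrite !(tnth_nth (omega1)) (tnth_nth (omega1 p)); case: k => [[|[|[|//]]] ?].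
      have [[m1 a1] [m2 a2] [m3 a3]] := And3 (s1.1 p I) (s2.1 p I) (s3.1 p I).
      by rewrite /wedge !tE; exact: su2_wedge.
  + move=> p X Y H; have [h [nd e1 e2 e3 [e4 _]]] := frame p.
    exact: (su2_positive nd e1 e2 e3).
- move=> p A.
  (* The pointwise identity, valid on all of N, is made an equality of forms so that it can be
     differentiated. *)
  have -> : wedge eta omega1 = (fun p A => - pullback f Psip p A).
    apply/funext => q; apply/funext => B; have [h [_ _ _ _ [_ H]]] := frame q.
    by rewrite H opprK.
  rewrite (ext_dN _ _ (smooth_pullback sf oD Df (onD _ _ sP))).
  by rewrite (ext_d_pullback sf _ oD (Df p) (onD _ _ sP)) /pullback dP oppr0.
- move=> p A; rewrite ext_d_wedge12//= !deta !domega2.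
  have [h [nd e1 e2 e3 [e4 _]]] := frame p.
  have [m1 al1] := s1.1 p I.
  rewrite /wedge !(ext_prod12 _ _ m1 al1).
  rewrite !nrow_mx3 !e1 !e2 !e3 !e4 /re12 /im12.
  by ring.
Qed.
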